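(* Let $S_j$ be local potentials satisfying (A)–(E), let $\omega\in\mathbb{R}^d$, let $x\in\overline{\mathcal{B}}_\omega$ be a global minimizer, let $[y^-,y^+]$ be a gap of the Aubry–Mather set $\mathcal{M}(x)$, and let $\Gamma$ be a ghost circle with $\mathcal{M}(x)\subset\Gamma$. Then either $\Gamma\cap[y^-,y^+]$ consists of global minimizers only, or there is at least one stationary configuration $y\in\Gamma\cap[y^-,y^+]$ that is not a global minimizer.
   Context: Notation: $\|i\|=\sum_{k=1}^d|i_k|$, $B_j^r=\{k:\|k-j\|\le r\}$, $(\tau_{k,l}x)_i=x_{i+k}+l$. Local potentials $S_j:\mathbb{R}^{\mathbb{Z}^d}\to\mathbb{R}$, $j\in\mathbb{Z}^d$, satisfy: (A) there is $r\in(0,\infty)$ and $C^2$ functions $s_j:\mathbb{R}^{B_j^r}\to\mathbb{R}$ with $S_j(x)=s_j(x|_{B_j^r})$; (B) $S_j(\tau_{k,l}x)=S_{j+k}(x)$; (C) each $S_j$ is bounded below and $S_j(x)\to\infty$ as $|x_k-x_j|\to\infty$ whenever $\|k-j\|=1$; (D) $\partial_{i,k}S_j\le0$ for $i\ne k$, and $\partial_{i,k}S_i<0$ when $\|i-k\|=1$; (E) $|\partial_{i,k}S_j|\le C$ uniformly. Order: $x\le y$ iff $x_i\le y_i$ for all $i$; $x\ll y$ iff $x_i<y_i$ for all $i$; $[a,b]=\{z:a\le z\le b\}$. Birkhoff, rotation vector: $\tau_{k,l}x\ge x$ or $\le x$ for all $(k,l)$; $\lim_nx_{ni}/n=\langle\omega,i\rangle$.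 $\overline{\mathcal{B}}_\omega$: Birkhoff configurations of rotation vector $\omega$ with $\tau_{k,l}x=x$ whenever $\langle\omega,k\rangle+l=0$. Stationary: $\sum_{\|j-i\|\le r}\partial_iS_j(x)=0$ for all $i$. Global minimizer: $W_B(x+y)\ge W_B(x)$ for every finite $B$ and every $y$ supported in $\mathring{B}^{(r)}=\{i\in B:B_i^r\subset B\}$, $W_B=\sum_{j\in B}S_j$. $\widetilde{\mathcal{M}}(x)$ is the pointwise closure of $\{\tau_{k,l}x:(k,l)\in\mathbb{Z}^d\times\mathbb{Z}\}$. The Aubry–Mather set $\mathcal{M}(x)$ is $\widetilde{\mathcal{M}}(x)$ if $\omega\in\mathbb{Q}^d$, and if $\omega\notin\mathbb{Q}^d$ it is $\{y\in\widetilde{\mathcal{M}}(x):y=\lim_n\tau_{k_n,l_n}y\text{ pointwise for some }(k_n,l_n)\text{ with }\langle\omega,k_n\rangle+l_n\ne0\}$. A gap of $\mathcal{M}(x)$ is an order interval $[y^-,y^+]$ with $y^-,y^+\in\mathcal{M}(x)$, $y^-\ll y^+$, containing no element of $\mathcal{M}(x)$ other than $y^\pm$. $\mathbb{X}=\{x:\sum_i2^{-\|i\|}|x_i|<\infty\}$; $(\nabla W(x))_i=\sum_{\|j-i\|\le r}\partial_iS_j(x)$; $\Psi_t$ the complete flow of $\dot x=-\nabla W(x)$ on $\mathbb{X}$. A ghost circle is a set $\Gamma$ that is nonempty, closed and connected (pointwise topology), strictly ordered (for $x,y\in\Gamma$: $x\ll y$, $x=y$ or $y\ll x$), shift-invariant,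 with $\Psi_t(\Gamma)=\Gamma$ for all $t$. *)

(* Defs.v *)
From Stdlib Require Import Reals List ZArith ClassicalEpsilon.
From Stdlib Require Fin.
Open Scope R_scope.

Definition Pt (d : nat) := Fin.t d -> Z.
Definition Conf (d : nat) := Pt d -> R.

Fixpoint fsum (d : nat) : (Fin.t d -> R) -> R :=
  match d return (Fin.t d -> R) -> R with
  | O => fun _ => 0
  | S n => fun f => f Fin.F1 + fsum n (fun a => f (Fin.FS a))
  end.

Definition padd {d} (i k : Pt d) : Pt d := fun a => (i a + k a)%Z.
Definition psub {d} (i k : Pt d) : Pt d := fun a => (i a - k a)%Z.
Definition pscale {d} (n : Z) (i : Pt d) : Pt d := fun a => (n * i a)%Z.
Definition pnorm {d} (i : Pt d) : R := fsum d (fun a => IZR (Z.abs (i a))).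
Definition ip {d} (w : Fin.t d -> R) (k : Pt d) : R := fsum d (fun a => w a * IZR (k a)).

Definition tau {d} (k : Pt d) (l : Z) (x : Conf d) : Conf d :=
  fun i => x (padd i k) + IZR l.

Definition cle {d} (x y : Conf d) : Prop := forall i, x i <= y i.
Definition cll {d} (x y : Conf d) : Prop := forall i, x i < y i.

Definition sum_over {d} (P : Pt d -> Prop) (f : Pt d -> R) (s : R) : Prop :=
  exists L : list (Pt d), NoDup L /\ (forall j, In j L <-> P j) /\
    s = fold_right Rplus 0 (map f L).

Definition upd {d} (x : Conf d) (i : Pt d) (t : R) : Conf d :=
  fun k => if excluded_middle_informative (k = i) then t else x k.

Definition is_partial {d} (f : Conf d -> R) (i : Pt d) (g : Conf d -> R) : Prop :=
  forall x, derivable_pt_lim (fun t => f (upd x i t)) (x i) (g x).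

Definition nbhd {d} (y : Conf d) (F : list (Pt d)) (eps : R) (z : Conf d) : Prop :=
  forall i, In i F -> Rabs (z i - y i) < eps.

Definition pw_continuous {d} (f : Conf d -> R) : Prop :=
  forall x eps, 0 < eps -> exists F delta, 0 < delta /\
    forall y, nbhd x F delta y -> Rabs (f y - f x) < eps.

Definition pw_open {d} (U : Conf d -> Prop) : Prop :=
  forall y, U y -> exists F eps, 0 < eps /\ forall z, nbhd y F eps z -> U z.

Definition pw_closure {d} (A : Conf d -> Prop) (y : Conf d) : Prop :=
  forall F eps, 0 < eps -> exists z, A z /\ nbhd y F eps z.

Definition pw_closed {d} (A : Conf d -> Prop) : Prop :=
  forall y, pw_closure A y -> A y.

Definition pw_connected {d} (A : Conf d -> Prop) : Prop :=
  forall U V : Conf d -> Prop, pw_open U -> pw_open V ->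
    (forall y, A y -> U y \/ V y) ->
    (exists y, A y /\ U y) -> (exists y, A y /\ V y) ->
    exists y, A y /\ U y /\ V y.

Definition potentials_ok (d : nat) (r : R) (S : Pt d -> Conf d -> R)
  (dS : Pt d -> Pt d -> Conf d -> R) (d2S : Pt d -> Pt d -> Pt d -> Conf d -> R) : Prop :=
  0 < r /\
  (forall j x y, (forall k, pnorm (psub k j) <= r -> x k = y k) -> S j x = S j y) /\
  (forall j i, is_partial (S j) i (dS j i)) /\
  (forall j i k, is_partial (dS j i) k (d2S j i k)) /\
  (forall j i, pw_continuous (dS j i)) /\
  (forall j i k, pw_continuous (d2S j i k)) /\
  (forall j k l x, S j (tau k l x) = S (padd j k) x) /\
  (forall j, exists m, forall x, m <= S j x) /\
  (forall j k, pnorm (psub k j) = 1 -> forall M, exists N, forall x,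
      N <= Rabs (x k - x j) -> M <= S j x) /\
  (forall j i k x, i <> k -> d2S j i k x <= 0) /\
  (forall i k x, pnorm (psub i k) = 1 -> d2S i i k x < 0) /\
  (exists C, forall j i k x, Rabs (d2S j i k x) <= C).

Definition birkhoff {d} (x : Conf d) : Prop :=
  forall k l, cle x (tau k l x) \/ cle (tau k l x) x.

Definition has_rotation_vector {d} (x : Conf d) (w : Fin.t d -> R) : Prop :=
  forall i, Un_cv (fun n => x (pscale (Z.of_nat n) i) / INR n) (ip w i).

Definition Bbar {d} (w : Fin.t d -> R) (x : Conf d) : Prop :=
  birkhoff x /\ has_rotation_vector x w /\
  (forall k l, ip w k + IZR l = 0 -> tau k l x = x).

(** W_B = sum_{j in B} S_j, for a finite set B given as a duplicate-free list *)
Definition W {d} (S : Pt d -> Conf d -> R) (B : list (Pt d)) (x : Conf d) : R :=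
  fold_right Rplus 0 (map (fun j => S j x) B).

Definition cadd {d} (x y : Conf d) : Conf d := fun i => x i + y i.

Definition global_minimizer {d} (r : R) (S : Pt d -> Conf d -> R) (x : Conf d) : Prop :=
  forall (B : list (Pt d)) (y : Conf d), NoDup B ->
    (forall i, y i <> 0 -> In i B /\ (forall k, pnorm (psub k i) <= r -> In k B)) ->
    W S B x <= W S B (cadd x y).

Definition gradW {d} (r : R) (dS : Pt d -> Pt d -> Conf d -> R) (x : Conf d) (i : Pt d) (g : R) : Prop :=
  sum_over (fun j => pnorm (psub j i) <= r) (fun j => dS j i x) g.

Definition stationary {d} (r : R) (dS : Pt d -> Pt d -> Conf d -> R) (x : Conf d) : Prop :=
  forall i, gradW r dS x i 0.

Definition inX {d} (x : Conf d) : Prop :=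
  exists M, forall L : list (Pt d), NoDup L ->
    fold_right Rplus 0 (map (fun i => Rpower 2 (- pnorm i) * Rabs (x i)) L) <= M.

Definition is_grad_flow {d} (r : R) (dS : Pt d -> Pt d -> Conf d -> R) (Psi : R -> Conf d -> Conf d) : Prop :=
  forall x, inX x ->
    Psi 0 x = x /\
    (forall t, inX (Psi t x)) /\
    (forall t i, exists g, gradW r dS (Psi t x) i g /\
                 derivable_pt_lim (fun s => Psi s x i) t (- g)).

Definition ghost_circle {d} (Psi : R -> Conf d -> Conf d) (G : Conf d -> Prop) : Prop :=
  (forall y, G y -> inX y) /\
  (exists y, G y) /\
  pw_closed G /\ pw_connected G /\
  (forall y z, G y -> G z -> cll y z \/ y = z \/ cll z y) /\
  (forall k l y, G y -> G (tau k l y)) /\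
  (forall t, (forall y, G y -> G (Psi t y)) /\ (forall z, G z -> exists y, G y /\ Psi t y = z)).

Definition Mtilde {d} (x : Conf d) : Conf d -> Prop :=
  pw_closure (fun z => exists k l, z = tau k l x).

Definition rational_vec {d} (w : Fin.t d -> R) : Prop :=
  forall a, exists p q : Z, q <> 0%Z /\ w a = IZR p / IZR q.

Definition AM {d} (w : Fin.t d -> R) (x : Conf d) (y : Conf d) : Prop :=
  Mtilde x y /\
  (rational_vec w \/
   exists (k : nat -> Pt d) (l : nat -> Z),
     (forall n, ip w (k n) + IZR (l n) <> 0) /\
     forall i, Un_cv (fun n => tau (k n) (l n) y i) (y i)).

Definition is_gap {d} (M : Conf d -> Prop) (ym yp : Conf d) : Prop :=
  M ym /\ M yp /\ cll ym yp /\
  forall z, M z -> cle ym z -> cle z yp -> z = ym \/ z = yp.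

(* Main.v *)
Require Import Defs.
From Stdlib Require Import Reals List ZArith Lra Lia.
From Stdlib Require Import FunctionalExtensionality ClassicalEpsilon.
From Coquelicot Require Import Coquelicot.
Open Scope R_scope.

(** A connected, strictly ordered, shift-invariant set [G] is a curve on which every
coordinate is a global parameter, and by shift invariance the gradient flow is
[x_i' = F (x_i)] on it, for one 1-periodic continuous function [F]. The flow being tangent to [G],
[F] does not change sign along a single configuration.

If some configuration of [G] in the gap is not stationary, let [u << v] be the closest
stationary configurations around it; the minimizing end among [u], [v] is the one from which
[F] points away. Following the curve from that end on a finite set [A] only, and freezing the
configuration outside [A], cannot lower the action. It lowers the action by
[D_i := |int_{u_i}^{v_i} F|] at every [i] in [A], up to an error [K (v_i - u_i)] at the sites near the
boundary of [A]. Sum this inequality over the finitely many distinct shifts of [[u,v]] by which some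
fixed [D_{i0} > 0] is carried to each site of [A]: distinct shifts are disjoint modulo 1 at each site, so
their widths add up to at most 1. Hence [|A| D_{i0} <= K |bd A|] for every [A], which is false for large
cubes. *)

Definition eq_dec_classic {T : Type} (x y : T) : {x = y} + {x <> y} :=
  excluded_middle_informative (x = y).

(** * Finite sums *)

Definition lsum {T : Type} (L : list T) (f : T -> R) : R := fold_right Rplus 0 (map f L).

Lemma lsum_cons {T : Type} (a : T) L f : lsum (a :: L) f = f a + lsum L f.
Proof. reflexivity. Qed.

Lemma lsum_nil {T : Type} (f : T -> R) : lsum nil f = 0.
Proof. reflexivity. Qed.

Lemma lsum_ext {T : Type} (L : list T) f g :
  (forall a, In a L -> f a = g a) -> lsum L f = lsum L g.
Proof.
  induction L as [|a L IH]; intros H; [reflexivity|].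
  rewrite !lsum_cons, (H a (or_introl eq_refl)), IH; auto with datatypes.
Qed.

Lemma lsum_le {T : Type} (L : list T) f g :
  (forall a, In a L -> f a <= g a) -> lsum L f <= lsum L g.
Proof.
  induction L as [|a L IH]; intros H; [apply Rle_refl|].
  rewrite !lsum_cons. apply Rplus_le_compat; auto with datatypes.
Qed.

Lemma lsum_const {T : Type} (L : list T) c : lsum L (fun _ => c) = INR (length L) * c.
Proof.
  induction L as [|a L IH]; [rewrite lsum_nil; simpl; ring|].
  rewrite lsum_cons, IH. cbn [length]. rewrite S_INR. ring.
Qed.

Lemma lsum_plus {T : Type} (L : list T) f g :
  lsum L (fun a => f a + g a) = lsum L f + lsum L g.
Proof.
  induction L as [|a L IH]; [rewrite !lsum_nil; ring|]. rewrite !lsum_cons, IH; ring.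
Qed.

Lemma lsum_minus {T : Type} (L : list T) f g :
  lsum L (fun a => f a - g a) = lsum L f - lsum L g.
Proof.
  induction L as [|a L IH]; [rewrite !lsum_nil; ring|]. rewrite !lsum_cons, IH; ring.
Qed.

Lemma lsum_scal {T : Type} (L : list T) c f : lsum L (fun a => c * f a) = c * lsum L f.
Proof.
  induction L as [|a L IH]; [rewrite !lsum_nil; ring|]. rewrite !lsum_cons, IH; ring.
Qed.

Lemma lsum_app {T : Type} (L L' : list T) f : lsum (L ++ L') f = lsum L f + lsum L' f.
Proof.
  induction L as [|a L IH]; [rewrite lsum_nil; simpl; ring|].
  simpl app. rewrite !lsum_cons, IH; ring.
Qed.

Lemma lsum_map {T U : Type} (h : T -> U) L f : lsum (map h L) f = lsum L (fun a => f (h a)).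
Proof. unfold lsum. now rewrite map_map. Qed.

Lemma lsum_swap {T U : Type} (L : list T) (L' : list U) f :
  lsum L (fun a => lsum L' (f a)) = lsum L' (fun b => lsum L (fun a => f a b)).
Proof.
  induction L as [|a L IH].
  - rewrite lsum_nil. erewrite lsum_ext; [|intros; apply lsum_nil]. rewrite lsum_const. ring.
  - rewrite lsum_cons, IH, <- lsum_plus. apply lsum_ext. intros; now rewrite lsum_cons.
Qed.

Lemma lsum_nonneg {T : Type} (L : list T) f :
  (forall a, In a L -> 0 <= f a) -> 0 <= lsum L f.
Proof.
  intros H. rewrite <- (Rmult_0_r (INR (length L))), <- lsum_const. now apply lsum_le.
Qed.

Lemma lsum_ge_term {T : Type} (L : list T) f a :
  (forall b, In b L -> 0 <= f b) -> In a L -> f a <= lsum L f.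
Proof.
  induction L as [|b L IH]; intros H; [easy|]. rewrite lsum_cons. intros [<-|Ha].
  - assert (0 <= lsum L f) by (apply lsum_nonneg; auto with datatypes). lra.
  - assert (0 <= f b) by auto with datatypes.
    assert (f a <= lsum L f) by (apply IH; auto with datatypes). lra.
Qed.

Lemma lsum_abs {T : Type} (L : list T) f : Rabs (lsum L f) <= lsum L (fun a => Rabs (f a)).
Proof.
  induction L as [|a L IH]; [rewrite !lsum_nil, Rabs_R0; lra|].
  rewrite !lsum_cons. eapply Rle_trans; [apply Rabs_triang|]. lra.
Qed.

Lemma lsum_filter {T : Type} (L : list T) (p : T -> bool) f :
  lsum L f = lsum (filter p L) f + lsum (filter (fun a => negb (p a)) L) f.
Proof.
  induction L as [|a L IH]; [unfold lsum; simpl; ring|].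
  cbn [filter]. rewrite lsum_cons, IH. destruct (p a); cbn [negb]; rewrite lsum_cons; ring.
Qed.

Lemma lsum_incl {T : Type} (L L' : list T) f :
  NoDup L -> NoDup L' -> incl L L' -> (forall a, In a L' -> ~ In a L -> f a = 0) ->
  lsum L' f = lsum L f.
Proof.
  revert L'. induction L as [|a L IH]; intros L' HL HL' Hi H0.
  - rewrite lsum_nil, (lsum_ext _ _ (fun _ => 0)), lsum_const by auto. ring.
  - destruct (in_split a L') as (L1 & L2 & ->); [auto with datatypes|].
    apply NoDup_remove in HL' as [HL' Ha]. inversion_clear HL as [|? ? Ha' HL0].
    rewrite lsum_app, !lsum_cons, <- (IH (L1 ++ L2)), lsum_app; auto; [ring| |].
    + intros b Hb. assert (Hb' : In b (L1 ++ a :: L2)) by auto with datatypes.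
      apply in_app_iff in Hb' as [?|[->|?]]; [|easy|]; apply in_app_iff; auto.
    + intros b Hb Hb'. apply H0.
      * apply in_app_iff in Hb as [?|?]; apply in_app_iff; simpl; auto.
      * intros [->|?]; auto.
Qed.

(** * Lattice points *)

Lemma fsum_nonneg n f : (forall a, 0 <= f a) -> 0 <= fsum n f.
Proof. induction n; intros H; simpl; [lra|]. apply Rplus_le_le_0_compat; auto. Qed.

Lemma fsum_ge_term n f a : (forall b, 0 <= f b) -> f a <= fsum n f.
Proof.
  intros H. induction a as [n|n a IH]; simpl.
  - assert (0 <= fsum n (fun b => f (Fin.FS b))) by (apply fsum_nonneg; auto). lra.
  - assert (f (Fin.FS a) <= fsum n (fun b => f (Fin.FS b))) by (apply (IH (fun b => f (Fin.FS b))); auto).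
    specialize (H Fin.F1). lra.
Qed.

Definition p0 {d} : Pt d := fun _ => 0%Z.

Ltac pt_ring := apply functional_extensionality; intros ?; unfold padd, psub, p0; ring.

Lemma padd_assoc {d} (i j k : Pt d) : padd (padd i j) k = padd i (padd j k).
Proof. pt_ring. Qed.
Lemma padd_comm {d} (i j : Pt d) : padd i j = padd j i.
Proof. pt_ring. Qed.
Lemma padd_p0_l {d} (i : Pt d) : padd p0 i = i.
Proof. pt_ring. Qed.
Lemma psub_padd {d} (m i : Pt d) : psub (padd m i) i = m.
Proof. pt_ring. Qed.
Lemma padd_psub {d} (j i : Pt d) : padd (psub j i) i = j.
Proof. pt_ring. Qed.
Lemma padd_inj {d} (k i j : Pt d) : padd i k = padd j k -> i = j.
Proof. intros H. rewrite <- (psub_padd i k), H. apply psub_padd. Qed.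

Lemma pnorm_psub_sym {d} (i j : Pt d) : pnorm (psub i j) = pnorm (psub j i).
Proof.
  unfold pnorm. f_equal. apply functional_extensionality. intros a. unfold psub.
  f_equal. lia.
Qed.

Lemma pnorm_self {d} (i : Pt d) : pnorm (psub i i) = 0.
Proof.
  unfold pnorm. replace (fun a => IZR (Z.abs (psub i i a))) with (fun _ : Fin.t d => 0).
  - induction d as [|n IH]; simpl; [reflexivity|]. rewrite IH; [ring|]. exact (fun _ => 0%Z).
  - apply functional_extensionality. intros a. unfold psub. now rewrite Z.sub_diag.
Qed.

Lemma pnorm_ge_coord {d} (i : Pt d) a : IZR (Z.abs (i a)) <= pnorm i.
Proof. apply (fsum_ge_term d (fun b => IZR (Z.abs (i b)))). intros. apply IZR_le. lia. Qed.

(** * Updates and mean values *)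

Lemma upd_same {d} (x : Conf d) i t : upd x i t i = t.
Proof. unfold upd. now destruct excluded_middle_informative. Qed.
Lemma upd_other {d} (x : Conf d) i t k : k <> i -> upd x i t k = x k.
Proof. intros. unfold upd. now destruct excluded_middle_informative. Qed.
Lemma upd_id {d} (x : Conf d) i : upd x i (x i) = x.
Proof.
  apply functional_extensionality. intros k. unfold upd.
  destruct excluded_middle_informative; congruence.
Qed.
Lemma upd_upd {d} (x : Conf d) i s t : upd (upd x i s) i t = upd x i t.
Proof.
  apply functional_extensionality. intros k. unfold upd.
  destruct excluded_middle_informative; congruence.
Qed.

Lemma partial_upd {d} (H : Conf d -> R) i h x t :
  is_partial H i h -> derivable_pt_lim (fun s => H (upd x i s)) t (h (upd x i t)).
Proof.
  intros Hp. specialize (Hp (upd x i t)). rewrite upd_same in Hp.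
  replace (fun s => H (upd x i s)) with (fun s => H (upd (upd x i t) i s)); [exact Hp|].
  apply functional_extensionality. intros s. now rewrite upd_upd.
Qed.

Lemma partial_mvt {d} (H : Conf d -> R) i h x t :
  is_partial H i h -> exists c, Rmin (x i) t <= c <= Rmax (x i) t /\
    H (upd x i t) - H x = h (upd x i c) * (t - x i).
Proof.
  intros Hp.
  destruct (MVT_gen (fun s => H (upd x i s)) (x i) t (fun s => h (upd x i s))) as (c & Hc & E).
  - intros s _. apply is_derive_Reals. now apply partial_upd.
  - intros s _. apply derivable_continuous_pt. exists (h (upd x i s)). now apply partial_upd.
  - exists c. split; [exact Hc|]. now rewrite upd_id in E.
Qed.

Definition between {d} (x y z : Conf d) : Prop :=
  forall i, Rmin (x i) (y i) <= z i <= Rmax (x i) (y i).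

(** The coordinates in [A] are changed one after the other, with the one-variable mean value theorem
    at each. Every term has its own intermediate configuration, but all stay in the box spanned by
    [x] and [x']. *)
Lemma mean_value_finite {d} (H : Conf d -> R) (h : Pt d -> Conf d -> R) (A : list (Pt d)) :
  NoDup A -> (forall i, In i A -> is_partial H i (h i)) -> forall x x',
  (forall k, ~ In k A -> x k = x' k) ->
  exists zs, (forall i, In i A -> between x x' (zs i)) /\
    H x' - H x = lsum A (fun i => h i (zs i) * (x' i - x i)).
Proof.
  induction A as [|i A IH]; intros Hnd Hp x x' E.
  - exists (fun _ => x). split; [easy|]. rewrite lsum_nil.
    replace x' with x; [ring|]. apply functional_extensionality. auto.
  (* The corner [z] keeps the old value at [i] only: the induction leads from [x] to [z], one more
     step from [z] to [x']. *)
  - inversion_clear Hnd as [|? ? Hi HA]. set (z := upd x' i (x i)).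
    destruct (IH HA (fun j Hj => Hp j (or_intror Hj)) x z) as (zs & Hb & Ez).
    { intros k Hk. unfold z. destruct (eq_dec_classic k i) as [->|n].
      - now rewrite upd_same.
      - rewrite upd_other by easy. apply E. intros [->|?]; auto. }
    destruct (partial_mvt H i (h i) z (x' i)) as (c & Hc & Ec); [auto with datatypes|].
    unfold z in Ec, Hc. rewrite upd_same in Ec, Hc. rewrite !upd_upd, upd_id in Ec.
    exists (fun j => if eq_dec_classic j i then upd x' i c else zs j). split.
    + intros j Hj. destruct (eq_dec_classic j i) as [->|n].
      * intros k. destruct (eq_dec_classic k i) as [->|n].
        -- rewrite upd_same. exact Hc.
        -- rewrite upd_other by easy. split; [apply Rmin_r|apply Rmax_r].
      * destruct Hj as [->|Hj]; [easy|]. intros k. specialize (Hb j Hj k). revert Hb.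
        unfold z. destruct (eq_dec_classic k i) as [->|n'].
        -- rewrite upd_same. unfold Rmin, Rmax. repeat destruct Rle_dec; lra.
        -- now rewrite upd_other.
    + rewrite lsum_cons. destruct (eq_dec_classic i i); [|easy]. rewrite <- Ec.
      replace (H x' - H x) with (H x' - H z + (H z - H x)) by ring. rewrite Ez.
      f_equal. apply lsum_ext. intros j Hj. destruct (eq_dec_classic j i) as [->|n]; [easy|].
      unfold z. now rewrite upd_other.
Qed.

(** * Pointwise continuity *)

Lemma nbhd_common {d} (x : Conf d) F1 F2 e1 e2 z :
  nbhd x (F1 ++ F2) (Rmin e1 e2) z -> nbhd x F1 e1 z /\ nbhd x F2 e2 z.
Proof.
  intros H. split; intros i Hi.
  - eapply Rlt_le_trans; [apply H, in_app_iff; auto|apply Rmin_l].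
  - eapply Rlt_le_trans; [apply H, in_app_iff; auto|apply Rmin_r].
Qed.

Lemma pw_continuous_plus {d} (f g : Conf d -> R) :
  pw_continuous f -> pw_continuous g -> pw_continuous (fun x => f x + g x).
Proof.
  intros Hf Hg x e He. destruct (Hf x (e/2)) as (F1 & e1 & He1 & H1); [lra|].
  destruct (Hg x (e/2)) as (F2 & e2 & He2 & H2); [lra|].
  exists (F1 ++ F2), (Rmin e1 e2). split; [now apply Rmin_pos|]. intros y Hy.
  apply nbhd_common in Hy as [Hy1 Hy2]. specialize (H1 y Hy1). specialize (H2 y Hy2).
  replace (f y + g y - (f x + g x)) with (f y - f x + (g y - g x)) by ring.
  eapply Rle_lt_trans; [apply Rabs_triang|]. lra.
Qed.

Lemma pw_continuous_lsum {d} {T : Type} (L : list T) (f : T -> Conf d -> R) :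
  (forall a, In a L -> pw_continuous (f a)) -> pw_continuous (fun x => lsum L (fun a => f a x)).
Proof.
  induction L as [|a L IH]; intros H.
  - intros x e He. exists nil, 1. split; [lra|]. intros. unfold lsum. simpl.
    now rewrite Rminus_diag, Rabs_R0.
  - apply (pw_continuous_plus (f a)); auto with datatypes.
Qed.

Lemma pw_continuous_coord {d} (F : R -> R) (i : Pt d) :
  (forall s, continuity_pt F s) -> pw_continuous (fun x => F (x i)).
Proof.
  intros HF x e He. destruct (HF (x i) e He) as (a & Ha & H).
  exists (i :: nil), a. split; [exact Ha|]. intros y Hy.
  destruct (Req_dec (y i) (x i)) as [->|n]; [now rewrite Rminus_diag, Rabs_R0|].
  apply (H (y i)). split; [split; [exact I|congruence]|]. apply Hy. now left.
Qed.

Lemma pw_continuous_nbhd_all {d} (A : list (Pt d)) (h : Pt d -> Conf d -> R) x e :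
  0 < e -> (forall i, In i A -> pw_continuous (h i)) ->
  exists F del, 0 < del /\ forall y i, In i A -> nbhd x F del y -> Rabs (h i y - h i x) < e.
Proof.
  intros He. induction A as [|i A IH]; intros H.
  - exists nil, 1. split; [lra|easy].
  - destruct IH as (F1 & e1 & He1 & H1); [auto with datatypes|].
    destruct (H i (or_introl eq_refl) x e He) as (F2 & e2 & He2 & H2).
    exists (F1 ++ F2), (Rmin e1 e2). split; [now apply Rmin_pos|].
    intros y j Hj Hy. apply nbhd_common in Hy as [Hy1 Hy2]. destruct Hj as [<-|Hj]; auto.
Qed.

(** * Real functions of one variable *)

(** Replaces integration of a derivative. The supremum of the points up to which the bound holds
    also satisfies it, and the local bound at a supremum below [q] would carry it further. *)
Lemma local_variation_bound (phi m : R -> R) p q :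
  p <= q -> (forall s s', p <= s -> s <= s' -> s' <= q -> m s <= m s') ->
  (forall t, p <= t <= q -> exists eta, 0 < eta /\ forall s, p <= s <= q ->
     Rabs (s - t) < eta -> Rabs (phi s - phi t) <= Rabs (m s - m t)) ->
  Rabs (phi q - phi p) <= m q - m p.
Proof.
  intros Hpq Hm Hloc.
  set (T := fun s => p <= s <= q /\ Rabs (phi s - phi p) <= m s - m p).
  assert (HTp : T p) by (split; [lra|]; rewrite !Rminus_diag, Rabs_R0; lra).
  destruct (completeness T) as (t & Hub & Hlub).
  { exists q. intros s [Hs _]. lra. }
  { now exists p. }
  assert (Ht : p <= t <= q).
  { split; [now apply Hub|]. apply Hlub. intros s [Hs _]. lra. }
  destruct (Hloc t Ht) as (eta & Heta & Hl).
  assert (HTt : T t).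
  { split; [exact Ht|].
    destruct (classic (exists s, T s /\ t - eta < s)) as [(s & Hs & Hst)|n].
    - assert (s <= t) by now apply Hub. destruct Hs as [Hs1 Hs2].
      assert (Ha : Rabs (s - t) < eta) by (apply Rabs_def1; lra).
      specialize (Hl s Hs1 Ha). specialize (Hm s t).
      rewrite Rabs_minus_sym, (Rabs_minus_sym (m s)), (Rabs_pos_eq (m t - m s)) in Hl by lra.
      replace (phi t - phi p) with (phi t - phi s + (phi s - phi p)) by ring.
      eapply Rle_trans; [apply Rabs_triang|]. lra.
    - exfalso. assert (t <= t - eta); [|lra]. apply Hlub. intros s Hs.
      apply Rnot_lt_le. intros H. apply n. eauto. }
  destruct (Rle_lt_or_eq_dec t q) as [Htq|<-]; [lra| |apply HTt].
  exfalso. set (s := Rmin q (t + eta/2)).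
  assert (Hs : t < s <= q /\ s <= t + eta/2) by (unfold s, Rmin; destruct Rle_dec; lra).
  assert (T s); [|assert (s <= t) by (now apply Hub); lra].
  destruct HTt as [_ HTt]. split; [lra|].
  assert (Ha : Rabs (s - t) < eta) by (apply Rabs_def1; lra).
  specialize (Hl s ltac:(lra) Ha). specialize (Hm t s).
  rewrite (Rabs_pos_eq (m s - m t)) in Hl by lra.
  replace (phi s - phi p) with (phi s - phi t + (phi t - phi p)) by ring.
  eapply Rle_trans; [apply Rabs_triang|]. lra.
Qed.

Definition open_R (P : R -> Prop) : Prop :=
  forall s, P s -> exists eta, 0 < eta /\ forall t, Rabs (t - s) < eta -> P t.

Lemma last_outside_below (P : R -> Prop) m z :
  open_R P -> m <= z -> ~ P m -> P z ->
  exists s, m <= s < z /\ ~ P s /\ forall t, s < t <= z -> P t.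
Proof.
  intros Ho Hmz Hm Hz. set (E := fun s => s <= z /\ ~ P s).
  destruct (completeness E) as (s & Hub & Hlub).
  { exists z. now intros s []. }
  { now exists m. }
  assert (Hs : ~ P s).
  { intros Ps. destruct (Ho s Ps) as (eta & He & Hn).
    assert (s <= s - eta); [|lra]. apply Hlub. intros t Ht. apply Rnot_lt_le. intros Hlt.
    apply Ht, Hn. assert (t <= s) by now apply Hub. apply Rabs_def1; lra. }
  exists s. assert (m <= s) by now apply Hub. assert (s <= z) by (apply Hlub; now intros ? []).
  assert (s <> z) by (intros ->; auto). repeat split; [lra|lra|exact Hs|].
  intros t Ht. apply NNPP. intros n. assert (t <= s); [|lra]. apply Hub. split; [lra|easy].
Qed.

Lemma first_outside_above (P : R -> Prop) m z :
  open_R P -> z <= m -> ~ P m -> P z ->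
  exists s, z < s <= m /\ ~ P s /\ forall t, z <= t < s -> P t.
Proof.
  intros Ho Hmz Hm Hz.
  destruct (last_outside_below (fun t => P (- t)) (- m) (- z)) as (s & Hs & Hns & Hp);
    rewrite ?Ropp_involutive; auto; [|lra|].
  - intros t Ht. destruct (Ho _ Ht) as (eta & He & Hn). exists eta. split; [easy|].
    intros u Hu. apply Hn. replace (- u - - t) with (- (u - t)) by ring. now rewrite Rabs_Ropp.
  - exists (- s). repeat split; [lra|lra|easy|]. intros t Ht.
    rewrite <- (Ropp_involutive t). apply Hp. lra.
Qed.

Lemma primitive_exists (F : R -> R) :
  (forall s, continuity_pt F s) -> exists Phi, forall s, derivable_pt_lim Phi s (F s).
Proof.
  intros HF. assert (HC : forall s, continuous F s) by (intros; now apply continuity_pt_filterlim).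
  exists (RInt F 0). intros s. apply is_derive_Reals.
  apply (is_derive_RInt F (RInt F 0) 0 s); [|apply HC].
  apply filter_forall. intros b. apply (RInt_correct F 0 b), ex_RInt_continuous. intros; apply HC.
Qed.

Lemma mvt_lim (Phi F : R -> R) a b :
  (forall s, derivable_pt_lim Phi s (F s)) -> a < b ->
  exists c, Phi b - Phi a = F c * (b - a) /\ a < c < b.
Proof. intros H Hab. apply MVT_cor2; auto. Qed.

Lemma primitive_mono (Phi F : R -> R) a b :
  (forall s, derivable_pt_lim Phi s (F s)) -> a <= b -> (forall s, a < s < b -> 0 <= F s) ->
  Phi a <= Phi b.
Proof.
  intros H Hab Hp. destruct (Rle_lt_or_eq_dec a b Hab) as [Hlt| ->]; [|lra].
  destruct (mvt_lim Phi F a b H Hlt) as (c & E & Hc). specialize (Hp c Hc). nra.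
Qed.

Lemma primitive_strict (Phi F : R -> R) a b z :
  (forall s, derivable_pt_lim Phi s (F s)) -> (forall s, a < s < b -> 0 <= F s) ->
  a < z < b -> 0 < F z -> Phi a < Phi b.
Proof.
  intros H Hp Hz HF. destruct (H z (F z) HF) as (del & Hd).
  set (h := Rmin (del/2) (b - z)). destruct del as [del Hdel]; simpl in *.
  assert (Hh : 0 < h <= b - z /\ h < del) by (unfold h, Rmin; destruct Rle_dec; lra).
  specialize (Hd h ltac:(lra) ltac:(rewrite Rabs_pos_eq; lra)).
  apply Rabs_def2 in Hd as [_ Hd].
  assert (Hq : 0 < (Phi (z + h) - Phi z) / h) by lra.
  assert (0 < Phi (z + h) - Phi z).
  { replace (Phi (z + h) - Phi z) with ((Phi (z + h) - Phi z) / h * h) by (field; lra).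
    apply Rmult_lt_0_compat; lra. }
  assert (Phi a <= Phi z) by (apply (primitive_mono Phi F); auto; [lra|]; intros; apply Hp; lra).
  assert (Phi (z + h) <= Phi b) by (apply (primitive_mono Phi F); auto; [lra|]; intros; apply Hp; lra).
  lra.
Qed.

(** [Phi] itself need not be periodic, but [Phi (s + l) - Phi s] has derivative zero. *)
Lemma primitive_shift (Phi F : R -> R) l :
  (forall s, derivable_pt_lim Phi s (F s)) -> (forall s, F (s + l) = F s) ->
  forall a b, Phi (b + l) - Phi (a + l) = Phi b - Phi a.
Proof.
  intros H HF. assert (Hd : forall s, derivable_pt_lim (fun s => Phi (s + l) - Phi s) s 0).
  { intros s. replace 0 with (F (s + l) * (1 + 0) - F s) by (rewrite HF; ring).
    apply (derivable_pt_lim_minus (fun s => Phi (s + l)) Phi); [|easy].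
    apply (derivable_pt_lim_comp (fun s => s + l) Phi); [|easy].
    apply (derivable_pt_lim_plus id (fun _ => l));
      [apply derivable_pt_lim_id|apply derivable_pt_lim_const]. }
  assert (Hlt : forall a b, a < b -> Phi (b + l) - Phi (a + l) = Phi b - Phi a).
  { intros a b Hab. destruct (mvt_lim _ (fun _ => 0) a b Hd Hab) as (c & E & _). lra. }
  intros a b. destruct (Rtotal_order a b) as [Hab|[->|Hab]]; [auto|ring|].
  specialize (Hlt b a Hab). lra.
Qed.

(** * Packing intervals *)

(** The first interval splits the others into those on its left and those on its right. Induction
    runs on a bound for the length, because both groups are filtered lists. *)
Lemma interval_packing {T : Type} (p q : T -> R) (n : nat) : forall (L : list T) a b,
  (length L <= n)%nat -> a <= b -> (forall k, In k L -> a <= p k /\ p k <= q k /\ q k <= b) ->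
  ForallOrdPairs (fun k k' => q k <= p k' \/ q k' <= p k) L ->
  lsum L (fun k => q k - p k) <= b - a.
Proof.
  induction n as [|n IH]; intros L a b Hn Hab Hin Hd.
  - destruct L; [rewrite lsum_nil; lra|simpl in Hn; lia].
  - destruct L as [|k L]; [rewrite lsum_nil; lra|].
    inversion_clear Hd as [|? ? Hk HL].
    destruct (Hin k (or_introl eq_refl)) as (Ha & Hpq & Hb).
    set (f := fun j => if Rle_dec (q j) (p k) then true else false).
    rewrite lsum_cons, (lsum_filter L f).
    assert (Hop : forall g, ForallOrdPairs (fun k k' => q k <= p k' \/ q k' <= p k) (filter g L)).
    { intros g. clear - HL. induction HL; simpl; [constructor|]. destruct (g a); [|easy].
      constructor; [|easy]. rewrite Forall_forall in *. intros j Hj.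
      apply filter_In in Hj as [Hj _]. auto. }
    assert (lsum (filter f L) (fun k => q k - p k) <= p k - a).
    { apply IH; auto.
      - pose proof (filter_length_le f L). simpl in Hn. lia.
      - intros j Hj. apply filter_In in Hj as [Hj Hf]. unfold f in Hf.
        destruct (Hin j (or_intror Hj)). destruct Rle_dec; [|easy]. tauto. }
    assert (lsum (filter (fun j => negb (f j)) L) (fun k => q k - p k) <= b - q k).
    { apply IH; auto.
      - pose proof (filter_length_le (fun j => negb (f j)) L). simpl in Hn. lia.
      - intros j Hj. apply filter_In in Hj as [Hj Hf]. unfold f in Hf.
        destruct (Hin j (or_intror Hj)). destruct Rle_dec; [easy|].
        rewrite Forall_forall in Hk. destruct (Hk j Hj); [tauto|easy]. }
    lra.
Qed.

Lemma integer_shift_into (c t : R) : exists l : Z, c <= t + IZR l < c + 1.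
Proof.
  exists (1 - up (t - c))%Z. rewrite minus_IZR. destruct (archimed (t - c)). lra.
Qed.

(** The intervals are arcs of the circle [R/Z]. It is cut at the left end of the first arc, and
    every arc is shifted to start in [[p k0, p k0 + 1)]. *)
Lemma circle_packing {T : Type} (p q : T -> R) (L : list T) :
  (forall k, In k L -> p k <= q k <= p k + 1) ->
  ForallOrdPairs (fun k k' => forall l : Z, p k <> p k' + IZR l /\
     (p k < p k' + IZR l -> q k <= p k' + IZR l) /\
     (p k' + IZR l < p k -> q k' + IZR l <= p k)) L ->
  lsum L (fun k => q k - p k) <= 1.
Proof.
  destruct L as [|k0 L]; intros Hin Hd; [rewrite lsum_nil; lra|].
  set (l := fun k => proj1_sig (constructive_indefinite_description _ (integer_shift_into (p k0) (p k)))).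
  assert (Hl : forall k, p k0 <= p k + IZR (l k) < p k0 + 1).
  { intros k. unfold l. now destruct constructive_indefinite_description. }
  inversion_clear Hd as [|? ? Hk HL].
  rewrite (lsum_ext _ _ (fun k => (q k + IZR (l k)) - (p k + IZR (l k)))) by (intros; ring).
  assert (E0 : l k0 = 0%Z).
  { assert (IZR (-1) < IZR (l k0) < IZR 1) as [H1 H2] by (specialize (Hl k0); simpl; lra).
    apply lt_IZR in H1, H2. lia. }
  replace 1 with (p k0 + 1 - p k0) by ring.
  apply (interval_packing _ _ (length (k0 :: L))); [lia|lra| |].
  - intros k Hk'. specialize (Hin k Hk') as Hpq. specialize (Hl k).
    split; [lra|split; [lra|]]. destruct Hk' as [<-|Hk'].
    + rewrite E0. simpl. lra.
    (* With the shift [l k - 1] the arc starts before [p k0], so it ends there at the latest; one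
       unit higher it does not pass [p k0 + 1]. *)
    + rewrite Forall_forall in Hk. destruct (Hk k Hk' (l k - 1)%Z) as (_ & _ & H).
      rewrite minus_IZR in H. lra.
  - assert (Hg : forall k k', (forall l : Z, p k <> p k' + IZR l /\
     (p k < p k' + IZR l -> q k <= p k' + IZR l) /\
     (p k' + IZR l < p k -> q k' + IZR l <= p k)) ->
      q k + IZR (l k) <= p k' + IZR (l k') \/ q k' + IZR (l k') <= p k + IZR (l k)).
    { intros k k' H. destruct (H (l k' - l k)%Z) as (H1 & H2 & H3). rewrite minus_IZR in *.
      destruct (Rtotal_order (p k) (p k' + (IZR (l k') - IZR (l k)))) as [Hlt|[He|Hlt]];
        [left|easy|right]; lra. }
    constructor.
    + apply (Forall_impl _ (fun a => Hg k0 a) Hk).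
    + clear - HL Hg. induction HL; constructor; auto. eapply Forall_impl; [|eassumption].
      intros b. apply Hg.
Qed.

(** Greedy selection: an element is kept only if it is unrelated to those kept so far; otherwise one
    of them represents it. *)
Lemma class_representatives {T : Type} (E : T -> T -> Prop) (L : list T) :
  (forall a, E a a) -> (forall a b, E a b -> E b a) ->
  exists L', ForallOrdPairs (fun a b => ~ E a b) L' /\
    forall a, In a L -> exists b, In b L' /\ E a b.
Proof.
  intros Hr Hs. induction L as [|a L (L' & Hd & Hc)].
  - exists nil. split; [constructor|easy].
  - destruct (classic (exists b, In b L' /\ E a b)) as [H|H].
    + exists L'. split; [easy|]. intros c [<-|Hin]; auto.
    + exists (a :: L'). split.
      * constructor; [|easy]. apply Forall_forall. intros b Hb Hab. apply H. eauto.
      * intros c [<-|Hin]; [exists a; simpl; auto|]. destruct (Hc c Hin) as (b & Hb & Hcb).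
        exists b. simpl. auto.
Qed.

(** * Cubes *)

Definition zrange (n : nat) : list Z :=
  map (fun m => (Z.of_nat m - Z.of_nat n)%Z) (seq 0 (2 * n + 1)).

Lemma zrange_length n : length (zrange n) = (2 * n + 1)%nat.
Proof. unfold zrange. now rewrite length_map, length_seq. Qed.

Lemma zrange_In n z : In z (zrange n) <-> (Z.abs z <= Z.of_nat n)%Z.
Proof.
  unfold zrange. rewrite in_map_iff. split.
  - intros (m & <- & Hm). apply in_seq in Hm. lia.
  - intros H. exists (Z.to_nat (z + Z.of_nat n)). rewrite in_seq. lia.
Qed.

Lemma zrange_NoDup n : NoDup (zrange n).
Proof.
  apply NoDup_map_NoDup_ForallPairs; [|apply seq_NoDup]. intros a b _ _ H. lia.
Qed.

Definition pcons {n} (z : Z) (k : Pt n) : Pt (S n) :=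
  fun a => Fin.caseS' a (fun _ => Z) z k.

Fixpoint cube (d n : nat) : list (Pt d) :=
  match d with
  | O => (fun _ => 0%Z) :: nil
  | S d' => map (fun zk => pcons (fst zk) (snd zk)) (list_prod (zrange n) (cube d' n))
  end.

Lemma cube_length d n : length (cube d n) = ((2 * n + 1) ^ d)%nat.
Proof.
  induction d as [|d IH]; [reflexivity|].
  simpl cube. now rewrite length_map, length_prod, zrange_length, IH.
Qed.

Lemma pcons_eta {n} (k : Pt (S n)) : k = pcons (k Fin.F1) (fun a => k (Fin.FS a)).
Proof.
  apply functional_extensionality. intros a. pattern a. now apply Fin.caseS'.
Qed.

Lemma cube_In d n (k : Pt d) : In k (cube d n) <-> forall a, (Z.abs (k a) <= Z.of_nat n)%Z.
Proof.
  induction d as [|d IH].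
  - simpl. split; [intros _ a; inversion a|]. intros _. left.
    apply functional_extensionality. intros a; inversion a.
  - simpl cube. rewrite in_map_iff. split.
    + intros ((z & k') & <- & H). apply in_prod_iff in H as [Hz Hk].
      apply zrange_In in Hz. rewrite IH in Hk. intros a. pattern a. now apply Fin.caseS'.
    + intros H. exists (k Fin.F1, fun a => k (Fin.FS a)). split; [symmetry; apply pcons_eta|].
      apply in_prod_iff. rewrite zrange_In, IH. auto.
Qed.

Lemma NoDup_product {T U : Type} (L : list T) (L' : list U) :
  NoDup L -> NoDup L' -> NoDup (list_prod L L').
Proof.
  intros HL HL'. induction HL as [|a L Ha HL IH]; simpl; [constructor|].
  apply NoDup_app; auto.
  - apply NoDup_map_NoDup_ForallPairs; [|easy]. intros b c _ _ E. congruence.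
  - intros (b & c) H1 H2. apply in_map_iff in H1 as (? & [= -> ->] & _).
    apply in_prod_iff in H2. tauto.
Qed.

Lemma cube_NoDup d n : NoDup (cube d n).
Proof.
  induction d as [|d IH]; simpl; [repeat constructor; easy|].
  apply NoDup_map_NoDup_ForallPairs; [|apply NoDup_product; auto using zrange_NoDup].
  intros (z, k) (z', k') _ _ E. simpl in E. f_equal.
  - exact (f_equal (fun f => f Fin.F1) E).
  - apply functional_extensionality. intros a. exact (f_equal (fun f => f (Fin.FS a)) E).
Qed.

Lemma bernoulli (x : R) n : 0 <= x <= 1 -> 1 - INR n * x <= (1 - x) ^ n.
Proof.
  intros Hx. induction n as [|n IH]; [simpl; lra|]. rewrite S_INR. simpl pow.
  assert ((1 - x) * (1 - INR n * x) <= (1 - x) * (1 - x) ^ n) by (apply Rmult_le_compat_l; lra).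
  assert (0 <= INR n * (x * x)) by (apply Rmult_le_pos; [apply pos_INR|nra]). nra.
Qed.

(** With [b] the side of the large cube and [x = 2 m / b], the small cube fills the share
    [(1 - x) ^ d]. By Bernoulli the shell has at most the share [d x], which tends to 0 as [n]
    grows. *)
Lemma cube_shell_negligible d (m : nat) (e : R) : 0 < e ->
  exists n : nat,
    INR (length (cube d (n + m))) - INR (length (cube d n)) < e * INR (length (cube d (n + m))).
Proof.
  (* The added 1 keeps the divisor positive when [d] or [m] is 0. *)
  intros He. destruct (archimed_cor1 (e / (INR d * (2 * INR m) + 1))) as (n & Hn & Hn0).
  { apply Rdiv_lt_0_compat; [easy|]. pose proof (pos_INR d). pose proof (pos_INR m). nra. }
  exists n. rewrite !cube_length, !pow_INR. set (b := INR (2 * (n + m) + 1)).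
  assert (Hb : INR n < b) by (apply lt_INR; lia).
  assert (Hnp : 0 < INR n) by now apply lt_0_INR.
  assert (Hm0 := pos_INR m). assert (Hd0 := pos_INR d).
  set (x := 2 * INR m / b).
  assert (Eb : b = 2 * (INR n + INR m) + 1).
  { unfold b. rewrite plus_INR, mult_INR, plus_INR. simpl. ring. }
  assert (Hx : 0 <= x <= 1).
  { unfold x. split; [apply Rdiv_le_0_compat; lra|]. apply Rle_div_l; lra. }
  assert (E : INR (2 * n + 1) = (1 - x) * b).
  { unfold x. rewrite plus_INR, mult_INR. simpl. field_simplify; [|lra]. rewrite Eb. ring. }
  rewrite E, Rpow_mult_distr. assert (Hbd : 0 < b ^ d) by (apply pow_lt; lra).
  pose proof (bernoulli x d Hx) as HB.
  assert (INR d * x < e); [|nra].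
  unfold x. apply Rle_lt_trans with ((INR d * (2 * INR m) + 1) * / INR n).
  - replace (INR d * (2 * INR m / b)) with ((INR d * (2 * INR m)) * / b) by (field; lra).
    apply Rmult_le_compat; [nra| |lra|].
    + left; apply Rinv_0_lt_compat; lra.
    + apply Rinv_le_contravar; lra.
  - apply Rmult_lt_compat_l with (r := INR d * (2 * INR m) + 1) in Hn; [|nra].
    replace ((INR d * (2 * INR m) + 1) * (e / (INR d * (2 * INR m) + 1))) with e in Hn; [easy|].
    field. nra.
Qed.

(** * The gradient of the action *)

Section GhostCircle.

Context {d : nat} {r C : R} {S : Pt d -> Conf d -> R}
  {dS : Pt d -> Pt d -> Conf d -> R} {d2S : Pt d -> Pt d -> Pt d -> Conf d -> R}
  {R0 : list (Pt d)}.
Context (R0_nodup : NoDup R0) (R0_ball : forall k, In k R0 <-> pnorm k <= r).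
Context (r_pos : 0 < r)
  (S_local : forall j x y, (forall k, pnorm (psub k j) <= r -> x k = y k) -> S j x = S j y)
  (S_partial : forall j i, is_partial (S j) i (dS j i))
  (dS_partial : forall j i k, is_partial (dS j i) k (d2S j i k))
  (dS_cont : forall j i, pw_continuous (dS j i))
  (S_shift : forall j k l x, S j (tau k l x) = S (padd j k) x)
  (d2S_bound : forall j i k x, Rabs (d2S j i k x) <= C).

(** By symmetry of the distance these are both the sites that [S i] can depend on and the [j] for
    which [S j] can feel site [i]. *)
Definition range (i : Pt d) : list (Pt d) := map (fun m => padd m i) R0.

(** The functional form of the relation [gradW]. *)
Definition grad (i : Pt d) (x : Conf d) : R := lsum (range i) (fun j => dS j i x).

Lemma range_In i j : In j (range i) <-> pnorm (psub j i) <= r.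
Proof.
  unfold range. rewrite in_map_iff. split.
  - intros (m & <- & Hm). rewrite psub_padd. now apply R0_ball.
  - intros H. exists (psub j i). split; [apply padd_psub|]. now apply R0_ball.
Qed.

Lemma range_sym i j : In j (range i) <-> In i (range j).
Proof. now rewrite !range_In, pnorm_psub_sym. Qed.

Lemma range_self i : In i (range i).
Proof. rewrite range_In, pnorm_self. lra. Qed.

Lemma range_NoDup i : NoDup (range i).
Proof.
  apply NoDup_map_NoDup_ForallPairs; [|easy]. intros a b _ _. apply padd_inj.
Qed.

Lemma range_length i : length (range i) = length R0.
Proof. apply length_map. Qed.

Lemma gradW_unique x i g : gradW r dS x i g -> g = grad i x.
Proof.
  intros (L & HL & Hin & ->). apply (lsum_incl (range i) L); auto using range_NoDup.
  - intros j Hj. now apply Hin, range_In.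
  - intros j Hj Hn. exfalso. now apply Hn, range_In, Hin.
Qed.

Lemma gradW_grad x i : gradW r dS x i (grad i x).
Proof.
  exists (range i). split; [apply range_NoDup|]. split; [|reflexivity]. apply range_In.
Qed.

Lemma stationary_grad x : stationary r dS x <-> forall i, grad i x = 0.
Proof.
  split; intros H i.
  - symmetry. apply gradW_unique, H.
  - rewrite <- (H i). apply gradW_grad.
Qed.

Lemma dS_shift j i k l x : dS j i (tau k l x) = dS (padd j k) (padd i k) x.
Proof.
  eapply uniqueness_limite; [apply S_partial|].
  set (i' := padd i k).
  assert (E : (fun t => S j (upd (tau k l x) i t)) = fun t => S (padd j k) (upd x i' (t - IZR l))).
  { apply functional_extensionality. intros t. rewrite <- (S_shift j k l). f_equal.
    apply functional_extensionality. intros n. unfold tau.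
    destruct (eq_dec_classic n i) as [->|Hn].
    - unfold i'. rewrite !upd_same. ring.
    - rewrite !upd_other; [reflexivity| |easy]. intros H. now apply padd_inj in H. }
  rewrite E. clear E.
  replace (dS (padd j k) i' x) with (dS (padd j k) i' (upd x i' (tau k l x i - IZR l)) * (1 - 0)).
  - apply (derivable_pt_lim_comp (fun t => t - IZR l) (fun t => S (padd j k) (upd x i' t))).
    + apply (derivable_pt_lim_minus id (fun _ => IZR l));
        [apply derivable_pt_lim_id|apply derivable_pt_lim_const].
    + now apply partial_upd.
  - unfold tau. fold i'. replace (x i' + IZR l - IZR l) with (x i') by ring.
    rewrite upd_id. ring.
Qed.

Lemma grad_shift i k l x : grad i (tau k l x) = grad (padd i k) x.
Proof.
  unfold grad, range. rewrite !lsum_map. apply lsum_ext. intros m _.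
  now rewrite dS_shift, padd_assoc.
Qed.

Lemma dS_outside j i x : ~ In i (range j) -> dS j i x = 0.
Proof.
  intros Hi. eapply uniqueness_limite; [apply S_partial|].
  replace (fun t => S j (upd x i t)) with (fun _ : R => S j x).
  - apply derivable_pt_lim_const.
  - apply functional_extensionality. intros t. apply S_local. intros k Hk.
    rewrite upd_other; [reflexivity|]. intros ->. now apply Hi, range_In.
Qed.

Lemma dS_local j i x x' : (forall k, In k (range j) -> x k = x' k) -> dS j i x = dS j i x'.
Proof.
  intros E. destruct (classic (In i (range j))) as [Hi|Hi]; [|now rewrite !dS_outside].
  eapply uniqueness_limite; [apply S_partial|]. rewrite (E i Hi).
  replace (fun t => S j (upd x i t)) with (fun t => S j (upd x' i t)); [apply S_partial|].
  apply functional_extensionality. intros t. apply S_local. intros k Hk.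
  destruct (eq_dec_classic k i) as [->|Hn]; [now rewrite !upd_same|].
  rewrite !upd_other by easy. symmetry. now apply E, range_In.
Qed.

Lemma dS_lipschitz j i x x' :
  Rabs (dS j i x - dS j i x') <= C * lsum (range j) (fun k => Rabs (x k - x' k)).
Proof.
  (* [y] differs from [x'] at finitely many sites, as the mean value formula demands, and agrees
     with [x] wherever [dS j i] looks. *)
  set (y := fun k => if excluded_middle_informative (In k (range j)) then x k else x' k).
  rewrite (dS_local j i x y).
  2: { intros k Hk. unfold y. now destruct excluded_middle_informative. }
  destruct (mean_value_finite (dS j i) (d2S j i) (range j) (range_NoDup j)
    (fun k _ => dS_partial j i k) x' y) as (zs & _ & ->).
  { intros k Hk. unfold y. now destruct excluded_middle_informative. }
  rewrite <- lsum_scal. eapply Rle_trans; [apply lsum_abs|]. apply lsum_le. intros k Hk.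
  rewrite Rabs_mult. unfold y. destruct excluded_middle_informative; [|easy].
  apply Rmult_le_compat_r; [apply Rabs_pos|easy].
Qed.

Lemma grad_cont i : pw_continuous (grad i).
Proof. apply (pw_continuous_lsum (range i) (fun j => dS j i)). auto. Qed.

Lemma grad_local i x x' :
  (forall j k, In j (range i) -> In k (range j) -> x k = x' k) -> grad i x = grad i x'.
Proof. intros E. apply lsum_ext. intros j Hj. apply dS_local. eauto. Qed.

(** The uniform price of a boundary site: [length R0] potentials enter the gradient, and each sees
    [length R0] coordinates that change by at most 1. *)
Lemma grad_oscillation i x x' : (forall k, Rabs (x k - x' k) <= 1) ->
  Rabs (grad i x - grad i x') <= C * (INR (length R0) * INR (length R0)).
Proof.
  intros H. unfold grad. rewrite <- lsum_minus. eapply Rle_trans; [apply lsum_abs|].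
  replace (C * (INR (length R0) * INR (length R0)))
    with (INR (length R0) * (C * INR (length R0))) by ring.
  rewrite <- (range_length i), <- lsum_const. apply lsum_le. intros j Hj.
  eapply Rle_trans; [apply dS_lipschitz|]. apply Rmult_le_compat_l.
  - eapply Rle_trans; [apply Rabs_pos|apply (d2S_bound p0 p0 p0 (fun _ => 0))].
  - rewrite range_length, <- (range_length j), <- (Rmult_1_r (INR _)), <- lsum_const.
    now apply lsum_le.
Qed.

Lemma W_partial_sum B i : is_partial (W S B) i (fun x => lsum B (fun j => dS j i x)).
Proof.
  intros x. unfold W. induction B as [|j B IH]; [apply derivable_pt_lim_const|].
  apply (derivable_pt_lim_plus (fun t => S j (upd x i t)) (fun t => W S B (upd x i t)));
    [apply S_partial|exact IH].
Qed.

Lemma W_partial B i : NoDup B -> incl (range i) B -> is_partial (W S B) i (grad i).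
Proof.
  intros HB Hi x. unfold grad. rewrite <- (lsum_incl (range i) B); auto using range_NoDup.
  - apply W_partial_sum.
  - intros j _ Hj. apply dS_outside. now rewrite <- range_sym.
Qed.

Lemma minimizer_stationary x i : global_minimizer r S x -> grad i x = 0.
Proof.
  intros Hm. set (f := fun t => W S (range i) (upd x i t)).
  assert (Hf : derivable_pt_lim f (x i) (grad i x)).
  { apply W_partial; [apply range_NoDup|apply incl_refl]. }
  set (pr := exist _ (grad i x) Hf : derivable_pt f (x i)).
  change (grad i x) with (derive_pt f (x i) pr).
  apply (deriv_minimum f (x i - 1) (x i + 1)); [lra|lra|]. intros t _ _.
  unfold f. rewrite upd_id.
  replace (upd x i t) with (cadd x (fun k => if eq_dec_classic k i then t - x i else 0)).
  - apply Hm; [apply range_NoDup|]. intros k. destruct eq_dec_classic as [->|]; [|easy].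
    intros _. split; [apply range_self|]. intros j. apply range_In.
  - apply functional_extensionality. intros k. unfold cadd.
    destruct eq_dec_classic as [->|Hn]; [rewrite upd_same; ring|rewrite upd_other by easy; ring].
Qed.

(** The gradient is continuous and compatible with shifts, so its vanishing passes to translates and
    their limits. This makes the whole Aubry-Mather set stationary. *)
Lemma closure_stationary x y : (forall i, grad i x = 0) -> Mtilde x y -> forall i, grad i y = 0.
Proof.
  intros Hx Hy i. apply NNPP. intros Hn.
  destruct (grad_cont i y (Rabs (grad i y))) as (F & e & He & H); [now apply Rabs_pos_lt|].
  destruct (Hy F e He) as (z & (k & l & ->) & Hz). specialize (H _ Hz).
  rewrite grad_shift, Hx in H. rewrite Rminus_0_l, Rabs_Ropp in H. lra.
Qed.

(** * Competitors that differ from a minimizer on a finite set *)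

Definition glue (A : list (Pt d)) (a y : Conf d) : Conf d :=
  fun k => if excluded_middle_informative (In k A) then y k else a k.

Lemma glue_in A a y k : In k A -> glue A a y k = y k.
Proof. intros. unfold glue. now destruct excluded_middle_informative. Qed.
Lemma glue_out A a y k : ~ In k A -> glue A a y k = a k.
Proof. intros. unfold glue. now destruct excluded_middle_informative. Qed.

(** Large enough to have [A] in its interior, so that variations supported in [A] are admissible for
    the action on [hull A]. *)
Definition hull (A : list (Pt d)) : list (Pt d) := nodup eq_dec_classic (flat_map range A).

Lemma hull_incl A i : In i A -> incl (range i) (hull A).
Proof. intros Hi j Hj. apply nodup_In, in_flat_map. eauto. Qed.

Lemma minimizer_glue A a y : global_minimizer r S a ->
  W S (hull A) a <= W S (hull A) (glue A a y).
Proof.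
  intros Hm. replace (glue A a y) with (cadd a (fun k => glue A a y k - a k)).
  - apply Hm; [apply NoDup_nodup|]. intros i Hi. destruct (classic (In i A)) as [Hin|Hout].
    + split; [apply (hull_incl A i Hin), range_self|]. intros k Hk.
      now apply (hull_incl A i Hin), range_In.
    + exfalso. apply Hi. rewrite glue_out by easy. ring.
  - apply functional_extensionality. intros k. unfold cadd. ring.
Qed.

(** * The curve of an ordered, connected, shift-invariant set *)

Context {G : Conf d -> Prop}.
Context (G_order : forall y z, G y -> G z -> cll y z \/ y = z \/ cll z y)
  (G_shift : forall k l y, G y -> G (tau k l y))
  (G_nonempty : exists y, G y) (G_connected : pw_connected G)
  (G_sign : forall y i k, G y -> 0 < grad i y -> 0 <= grad k y).

(** If the value [s] were omitted, the open conditions [y i < s] and [s < y i] would disconnect [G];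
    integer shifts of one element show that both occur. *)
Lemma coord_surjective i s : exists y, G y /\ y i = s.
Proof.
  apply NNPP. intros Hn. destruct G_nonempty as (e & He).
  destruct (G_connected (fun y => y i < s) (fun y => s < y i)) as (y & _ & H1 & H2); [| | | | |lra].
  - intros y Hy. exists (i :: nil), (s - y i). split; [lra|]. intros z Hz.
    specialize (Hz i (or_introl eq_refl)). apply Rabs_def2 in Hz. lra.
  - intros y Hy. exists (i :: nil), (y i - s). split; [lra|]. intros z Hz.
    specialize (Hz i (or_introl eq_refl)). apply Rabs_def2 in Hz. lra.
  - intros y Hy. destruct (Rtotal_order (y i) s) as [?|[?|?]]; auto. exfalso. eauto.
  - destruct (integer_shift_into (s - 1) (e (padd i p0))) as (l & Hl).
    exists (tau p0 l e). split; [auto|]. unfold tau. lra.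
  - destruct (integer_shift_into (s + 1) (e (padd i p0))) as (l & Hl).
    exists (tau p0 l e). split; [auto|]. unfold tau. lra.
Qed.

Lemma coord_lt y z i : G y -> G z -> y i < z i -> cll y z.
Proof.
  intros Hy Hz H. destruct (G_order y z Hy Hz) as [?|[->|Hc]]; [easy|lra|].
  specialize (Hc i). lra.
Qed.

Lemma coord_injective y z i : G y -> G z -> y i = z i -> y = z.
Proof.
  intros Hy Hz H. destruct (G_order y z Hy Hz) as [Hc|[?|Hc]]; [|easy|];
    specialize (Hc i); lra.
Qed.

(** One coordinate determines a configuration of [G]; the one at the origin serves as parameter. *)
Definition curve (s : R) : Conf d :=
  proj1_sig (constructive_indefinite_description _ (coord_surjective p0 s)).

Lemma curve_in s : G (curve s).
Proof. unfold curve. now destruct constructive_indefinite_description. Qed.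

Lemma curve_p0 s : curve s p0 = s.
Proof. unfold curve. now destruct constructive_indefinite_description. Qed.

Lemma curve_of y : G y -> curve (y p0) = y.
Proof. intros Hy. apply (coord_injective _ _ p0); auto using curve_in, curve_p0. Qed.

Lemma curve_lt s s' : s < s' -> cll (curve s) (curve s').
Proof. intros H. apply (coord_lt _ _ p0); auto using curve_in. now rewrite !curve_p0. Qed.

Lemma curve_le s s' : s <= s' -> cle (curve s) (curve s').
Proof.
  intros [H| ->] i; [|lra]. left. now apply curve_lt.
Qed.

(** Two elements of [G] take the values [curve t k - e] and [curve t k + e] at [k]. By the order,
    parameters between their values at the origin give configurations between them. *)
Lemma curve_continuous t k e : 0 < e ->
  exists eta, 0 < eta /\ forall s, Rabs (s - t) < eta -> Rabs (curve s k - curve t k) < e.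
Proof.
  intros He. destruct (coord_surjective k (curve t k - e)) as (y & Hy & Ey).
  destruct (coord_surjective k (curve t k + e)) as (y' & Hy' & Ey').
  assert (H1 : y p0 < t).
  { rewrite <- (curve_p0 t). apply (coord_lt _ _ k); auto using curve_in. lra. }
  assert (H2 : t < y' p0).
  { rewrite <- (curve_p0 t). apply (coord_lt _ _ k); auto using curve_in. lra. }
  exists (Rmin (t - y p0) (y' p0 - t)). split; [apply Rmin_pos; lra|]. intros s Hs.
  apply Rabs_def2 in Hs. pose proof (Rmin_l (t - y p0) (y' p0 - t)).
  pose proof (Rmin_r (t - y p0) (y' p0 - t)).
  assert (H3 : y k < curve s k).
  { rewrite <- (curve_of y Hy). apply curve_lt. lra. }
  assert (H4 : curve s k < y' k).
  { rewrite <- (curve_of y' Hy'). apply curve_lt. lra. }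
  apply Rabs_def1; lra.
Qed.

Lemma curve_continuous_finite t (F : list (Pt d)) e : 0 < e ->
  exists eta, 0 < eta /\ forall s, Rabs (s - t) < eta -> nbhd (curve t) F e (curve s).
Proof.
  intros He. induction F as [|k F (e1 & He1 & H1)].
  - exists 1. split; [lra|]. now intros s _ i [].
  - destruct (curve_continuous t k e He) as (e2 & He2 & H2).
    exists (Rmin e1 e2). split; [now apply Rmin_pos|]. intros s Hs i [<-|Hi].
    + apply H2. eapply Rlt_le_trans; [exact Hs|apply Rmin_r].
    + apply H1; [|easy]. eapply Rlt_le_trans; [exact Hs|apply Rmin_l].
Qed.

(* By shift invariance the gradient flow on the curve moves every coordinate [y i] of
   every configuration with the velocity [speed (y i)]. *)
Definition speed (s : R) : R := - grad p0 (curve s).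

Lemma grad_speed y i : G y -> grad i y = - speed (y i).
Proof.
  intros Hy. unfold speed. rewrite Ropp_involutive.
  (* The translate lies in [G] and has the value [y i] at the origin, so it is the point of the
     curve with this parameter. *)
  replace (curve (y i)) with (tau i 0 y).
  - now rewrite grad_shift, padd_p0_l.
  - symmetry. replace (y i) with (tau i 0 y p0); [now apply curve_of, G_shift|].
    unfold tau. rewrite padd_p0_l. simpl. ring.
Qed.

Lemma speed_shift s l : speed (s + IZR l) = speed s.
Proof.
  rewrite <- (Ropp_involutive (speed s)).
  pose proof (grad_speed (curve s) p0 (curve_in s)) as E. rewrite curve_p0 in E.
  rewrite <- E, <- (padd_p0_l p0), <- (grad_shift p0 p0 l), grad_speed by auto using curve_in.
  rewrite Ropp_involutive. f_equal. unfold tau. now rewrite padd_p0_l, curve_p0.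
Qed.

Lemma speed_continuous s : continuity_pt speed s.
Proof.
  intros e He. destruct (grad_cont p0 (curve s) e He) as (F & del & Hdel & H).
  destruct (curve_continuous_finite s F del Hdel) as (eta & Heta & Hc).
  exists eta. split; [exact Heta|]. intros t [_ Ht]. simpl in *. unfold R_dist, speed in *.
  replace (- grad p0 (curve t) - - grad p0 (curve s))
    with (- (grad p0 (curve t) - grad p0 (curve s))) by ring.
  rewrite Rabs_Ropp. auto.
Qed.

Definition Phi : R -> R :=
  proj1_sig (constructive_indefinite_description _ (primitive_exists speed speed_continuous)).

Lemma Phi_deriv s : derivable_pt_lim Phi s (speed s).
Proof. unfold Phi. now destruct constructive_indefinite_description. Qed.

(** The factor [sg] treats both directions of motion at once; for [sg = 1] the hypothesis [G_sign]
    is used with the two sites interchanged. *)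
Lemma speed_sign y i k sg : G y -> sg = 1 \/ sg = -1 ->
  0 < sg * speed (y i) -> 0 <= sg * speed (y k).
Proof.
  intros Hy Hsg H. pose proof (grad_speed y i Hy) as Ei. pose proof (grad_speed y k Hy) as Ek.
  apply Rnot_lt_le. intros Hk. destruct Hsg as [-> | ->].
  - assert (0 <= grad i y) by (apply (G_sign y k i Hy); lra). lra.
  - assert (0 <= grad k y) by (apply (G_sign y i k Hy); lra). lra.
Qed.

(** * Parameter intervals on which the flow moves in one direction *)

Definition moving (sg s : R) : Prop := exists i, 0 < sg * speed (curve s i).

Lemma moving_at_nbhd sg i s : 0 < sg * speed (curve s i) ->
  exists eta, 0 < eta /\ forall t, Rabs (t - s) < eta -> 0 < sg * speed (curve t i).
Proof.
  intros Hi.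
  assert (Hs : continuity_pt (fun t => sg * speed t) (curve s i)).
  { apply (continuity_pt_scal speed), speed_continuous. }
  destruct (Hs _ Hi) as (del & Hdel & H).
  destruct (curve_continuous s i del Hdel) as (eta & Heta & Hc).
  exists eta. split; [easy|]. intros t Ht.
  destruct (Req_dec (curve t i) (curve s i)) as [->|n]; [easy|].
  specialize (H (curve t i)). simpl in H. unfold R_dist in H.
  specialize (H ltac:(split; [split; [exact I|congruence]|auto])).
  apply Rabs_def2 in H. lra.
Qed.

Lemma moving_open sg : open_R (moving sg).
Proof.
  intros s (i & Hi). destruct (moving_at_nbhd sg i s Hi) as (eta & He & H).
  exists eta. split; [easy|]. intros t Ht. exists i. auto.
Qed.

(* A boundary point of the moving set at which the velocity does not have the sign [sg]
   cannot carry the opposite sign either, since that condition is open as well. *)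
Lemma moving_boundary sg s : sg = 1 \/ sg = -1 -> ~ moving sg s ->
  (forall eta, 0 < eta -> exists t, Rabs (t - s) < eta /\ moving sg t) ->
  forall i, grad i (curve s) = 0.
Proof.
  intros Hsg Hn Hnear i. rewrite grad_speed by apply curve_in.
  destruct (Rtotal_order (sg * speed (curve s i)) 0) as [Hlt|[He|Hgt]].
  - exfalso. destruct (moving_at_nbhd (- sg) i s) as (eta & Heta & H); [lra|].
    destruct (Hnear eta Heta) as (t & Ht & k & Hk). specialize (H t Ht).
    pose proof (speed_sign (curve t) k i sg (curve_in t) Hsg Hk). lra.
  - destruct Hsg as [-> | ->]; lra.
  - exfalso. apply Hn. now exists i.
Qed.

Lemma stationary_not_moving sg y : G y -> (forall i, grad i y = 0) -> ~ moving sg (y p0).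
Proof.
  intros Hy H (i & Hi). rewrite curve_of in Hi by easy.
  specialize (H i). rewrite grad_speed in H by easy.
  replace (speed (y i)) with 0 in Hi by lra. lra.
Qed.

(** From [z] the curve is followed down and up until motion in the direction [sg] stops. The
    stationary [ym] and [yp] force this to happen between them, and the stopping points are
    stationary by [moving_boundary]. *)
Lemma moving_interval sg ym yp z : sg = 1 \/ sg = -1 -> G ym -> G yp -> G z ->
  (forall i, grad i ym = 0) -> (forall i, grad i yp = 0) -> cle ym z -> cle z yp ->
  moving sg (z p0) ->
  exists u v, G u /\ G v /\ cle ym u /\ cle v yp /\ cll u z /\ cll z v /\
    (forall i, grad i u = 0) /\ (forall i, grad i v = 0) /\
    (forall y, G y -> cll u y -> cll y v -> moving sg (y p0)).
Proof.
  intros Hsg Gm Gp Gz Hm Hp Hmz Hzp Hz.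
  destruct (last_outside_below (moving sg) (ym p0) (z p0)) as (a & Ha & Hna & Hma);
    auto using moving_open, stationary_not_moving.
  destruct (first_outside_above (moving sg) (yp p0) (z p0)) as (b & Hb & Hnb & Hmb);
    auto using moving_open, stationary_not_moving.
  exists (curve a), (curve b).
  rewrite <- (curve_of ym Gm), <- (curve_of yp Gp).
  assert (Hz' : z = curve (z p0)) by (symmetry; now apply curve_of).
  repeat split; try apply curve_in.
  - apply curve_le. lra.
  - apply curve_le. lra.
  - rewrite Hz'. apply curve_lt. lra.
  - rewrite Hz'. apply curve_lt. lra.
  - apply (moving_boundary sg); auto. intros eta He.
    exists (Rmin (z p0) (a + eta / 2)). split.
    + apply Rabs_def1; unfold Rmin; destruct Rle_dec; lra.
    + apply Hma. unfold Rmin; destruct Rle_dec; lra.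
  - apply (moving_boundary sg); auto. intros eta He.
    exists (Rmax (z p0) (b - eta / 2)). split.
    + apply Rabs_def1; unfold Rmax; destruct Rle_dec; lra.
    + apply Hmb. unfold Rmax; destruct Rle_dec; lra.
  - intros y Hy Hay Hyb. specialize (Hay p0). specialize (Hyb p0). rewrite curve_p0 in *.
    destruct (Rle_lt_dec (y p0) (z p0)); [apply Hma|apply Hmb]; lra.
Qed.

(** * Energy along the curve *)

(** The primitive of [speed] compensates the change of the action along the curve: the partial
    derivatives in [A] become [grad i x + speed (x i)], which vanish on [G]. *)
Definition energy (A : list (Pt d)) (x : Conf d) : R :=
  W S (hull A) x + lsum A (fun i => Phi (x i)).

Lemma potential_partial A i : NoDup A -> In i A ->
  is_partial (fun x : Conf d => lsum A (fun k => Phi (x k))) i (fun x => speed (x i)).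
Proof.
  intros HA Hi x.
  replace (speed (x i)) with (lsum A (fun k => if eq_dec_classic k i then speed (x i) else 0)).
  - clear HA Hi. induction A as [|k A IH]; [apply derivable_pt_lim_const|].
    apply (derivable_pt_lim_plus (fun t => Phi (upd x i t k))
      (fun t => lsum A (fun k => Phi (upd x i t k)))); [|exact IH].
    destruct eq_dec_classic as [->|n].
    + replace (fun t => Phi (upd x i t i)) with Phi; [apply Phi_deriv|].
      apply functional_extensionality. intros t. now rewrite upd_same.
    + replace (fun t => Phi (upd x i t k)) with (fun _ : R => Phi (x k));
        [apply derivable_pt_lim_const|].
      apply functional_extensionality. intros t. now rewrite upd_other.
  - rewrite (lsum_incl (i :: nil) A); auto.
    + rewrite lsum_cons, lsum_nil. destruct eq_dec_classic; [ring|easy].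
    + repeat constructor; easy.
    + intros k [<-|[]]; auto.
    + intros k _ Hk. destruct eq_dec_classic as [->|]; [|easy]. exfalso. apply Hk. now left.
Qed.

Lemma energy_partial A i : NoDup A -> In i A ->
  is_partial (energy A) i (fun x : Conf d => grad i x + speed (x i)).
Proof.
  intros HA Hi x.
  apply (derivable_pt_lim_plus (fun t => W S (hull A) (upd x i t))
    (fun t => lsum A (fun k => Phi (upd x i t k)))).
  - apply W_partial; [apply NoDup_nodup|now apply hull_incl].
  - now apply potential_partial.
Qed.

Definition deep (A : list (Pt d)) (i : Pt d) : Prop :=
  forall j k, In j (range i) -> In k (range j) -> In k A.

Definition osc : R := C * (INR (length R0) * INR (length R0)).

Lemma osc_nonneg : 0 <= osc.
Proof.
  assert (0 <= C) by (eapply Rle_trans; [apply Rabs_pos|apply (d2S_bound p0 p0 p0 (fun _ => 0))]).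
  pose proof (pos_INR (length R0)). apply Rmult_le_pos; nra.
Qed.

Definition err (A : list (Pt d)) (i : Pt d) : R :=
  if excluded_middle_informative (deep A i) then 0 else osc.

Lemma err_bound A a y i : G y -> (forall k, Rabs (a k - y k) <= 1) -> In i A ->
  Rabs (grad i (glue A a y) + speed (glue A a y i)) <= err A i.
Proof.
  intros Hy Ha Hi. rewrite glue_in by easy.
  replace (speed (y i)) with (- grad i y) by (rewrite grad_speed by easy; ring).
  unfold err. destruct excluded_middle_informative as [Hd|Hd].
  - rewrite (grad_local i (glue A a y) y), Rplus_opp_r, Rabs_R0; [lra|].
    intros j k Hj Hk. apply glue_in. eapply Hd; eauto.
  - apply grad_oscillation. intros k. unfold glue.
    destruct excluded_middle_informative; [|easy]. rewrite Rminus_diag, Rabs_R0. lra.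
Qed.

(** The curve is known to be continuous and increasing, not differentiable, so the energy is
    compared with the increasing function [m] through [local_variation_bound]. The slack [e] absorbs
    the variation of the partial derivatives near a parameter. *)
Lemma energy_variation_eps A a p q e : NoDup A -> p <= q -> 0 < e ->
  (forall s k, p <= s <= q -> Rabs (a k - curve s k) <= 1) ->
  Rabs (energy A (glue A a (curve q)) - energy A (glue A a (curve p))) <=
  lsum A (fun i => (err A i + e) * (curve q i - curve p i)).
Proof.
  intros HA Hpq He Ha.
  assert (Hw : forall i, 0 <= err A i + e).
  { intros i. unfold err. pose proof osc_nonneg. destruct excluded_middle_informative; lra. }
  set (m := fun s => lsum A (fun i => (err A i + e) * curve s i)).
  assert (Em : forall s s', m s' - m s = lsum A (fun i => (err A i + e) * (curve s' i - curve s i))).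
  { intros s s'. unfold m. rewrite <- lsum_minus. apply lsum_ext. intros; ring. }
  assert (Hm : forall s s', s <= s' -> m s <= m s').
  { intros s s' Hss. apply lsum_le. intros i _. apply Rmult_le_compat_l; [easy|].
    now apply curve_le. }
  rewrite <- Em.
  apply (local_variation_bound (fun s => energy A (glue A a (curve s)))); [easy|auto|].
  intros t Ht.
  destruct (pw_continuous_nbhd_all A (fun i (x : Conf d) => grad i x + speed (x i))
    (glue A a (curve t)) e He) as (F & del & Hdel & H).
  { intros i _. apply pw_continuous_plus; [apply grad_cont|].
    apply pw_continuous_coord, speed_continuous. }
  destruct (curve_continuous_finite t F del Hdel) as (eta & Heta & Hc).
  exists eta. split; [easy|]. intros s Hs Hst.
  destruct (mean_value_finite (energy A) (fun i (x : Conf d) => grad i x + speed (x i)) A HA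
    (fun i Hi => energy_partial A i HA Hi) (glue A a (curve t)) (glue A a (curve s)))
    as (zs & Hz & ->).
  { intros k Hk. now rewrite !glue_out. }
  (* All coordinates move the same way along the curve, so nothing cancels in the increment of
     [m]. *)
  assert (Habs : Rabs (m s - m t) = lsum A (fun i => (err A i + e) * Rabs (curve s i - curve t i))).
  { destruct (Rle_dec t s) as [Hle|Hle].
    - rewrite Rabs_pos_eq by (specialize (Hm t s Hle); lra). rewrite Em. apply lsum_ext.
      intros i _. rewrite Rabs_pos_eq; [easy|]. pose proof (curve_le t s Hle i). lra.
    - assert (Hle' : s <= t) by lra.
      rewrite Rabs_minus_sym, Rabs_pos_eq by (specialize (Hm s t Hle'); lra).
      rewrite Em. apply lsum_ext.
      intros i _. rewrite Rabs_minus_sym, Rabs_pos_eq; [easy|].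
      pose proof (curve_le s t Hle' i). lra. }
  rewrite Habs. eapply Rle_trans; [apply lsum_abs|]. apply lsum_le. intros i Hi.
  rewrite Rabs_mult, !glue_in by easy. apply Rmult_le_compat_r; [apply Rabs_pos|].
  (* In [A] the intermediate values lie between two close ones, outside [A] they equal [a]; so the
     estimate at [curve t] is available up to [e]. *)
  assert (Hnb : nbhd (glue A a (curve t)) F del (zs i)).
  { intros k Hk. specialize (Hz i Hi k). specialize (Hc s Hst k Hk). revert Hz.
    unfold glue. destruct excluded_middle_informative; intros Hz.
    - apply Rabs_def2 in Hc. unfold Rmin, Rmax in Hz. apply Rabs_def1;
        repeat destruct Rle_dec; lra.
    - rewrite Rmin_left, Rmax_left in Hz by lra.
      replace (zs i k) with (a k) by lra. now rewrite Rminus_diag, Rabs_R0. }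
  specialize (H (zs i) i Hi Hnb). simpl in H.
  pose proof (err_bound A a (curve t) i (curve_in t) (fun k => Ha t k Ht) Hi) as Hb.
  set (X := grad i (zs i) + _) in *. set (X0 := grad i (glue _ _ _) + _) in *.
  replace X with (X - X0 + X0) by ring. eapply Rle_trans; [apply Rabs_triang|]. lra.
Qed.

Lemma energy_variation A a p q : NoDup A -> p <= q ->
  (forall s k, p <= s <= q -> Rabs (a k - curve s k) <= 1) ->
  Rabs (energy A (glue A a (curve q)) - energy A (glue A a (curve p))) <=
  lsum A (fun i => err A i * (curve q i - curve p i)).
Proof.
  intros HA Hpq Ha. set (T := lsum A (fun i => curve q i - curve p i)).
  assert (HT : 0 <= T).
  { apply lsum_nonneg. intros i _. pose proof (curve_le p q Hpq i). lra. }
  apply le_epsilon. intros e He.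
  assert (He' : 0 < e / (T + 1)) by (apply Rdiv_lt_0_compat; lra).
  eapply Rle_trans; [apply (energy_variation_eps A a p q _ HA Hpq He' Ha)|].
  rewrite (lsum_ext _ _ (fun i => err A i * (curve q i - curve p i)
    + e / (T + 1) * (curve q i - curve p i))) by (intros; ring).
  rewrite lsum_plus, lsum_scal. fold T. apply Rplus_le_compat_l.
  replace (e / (T + 1) * T) with (e - e / (T + 1)) by (field; lra). lra.
Qed.

(* The glued configurations cannot have less action than the minimizing end, while
   following the curve inside [A] changes the action by the increment of [- Phi] up to the
   boundary terms [err]. *)
Lemma dissipation_bound sg A u v : NoDup A -> G u -> G v -> cll u v ->
  (forall k, v k <= u k + 1) ->
  (sg = 1 /\ global_minimizer r S u) \/ (sg = -1 /\ global_minimizer r S v) ->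
  lsum A (fun i => sg * (Phi (v i) - Phi (u i))) <= lsum A (fun i => err A i * (v i - u i)).
Proof.
  intros HA Hu Hv Huv H1 Hmin.
  (* The exterior is frozen at the minimizing end: [u] for [sg = 1], [v] for [sg = -1]. *)
  set (a := if Rle_dec 0 sg then u else v).
  assert (Hb : Rabs (energy A (glue A a v) - energy A (glue A a u))
    <= lsum A (fun i => err A i * (v i - u i))).
  { rewrite <- (curve_of u Hu), <- (curve_of v Hv). apply energy_variation; [easy| |].
    - left. apply Huv.
    - intros s k Hs. pose proof (curve_le _ _ (proj1 Hs) k) as H2.
      pose proof (curve_le _ _ (proj2 Hs) k) as H3. rewrite curve_of in H2, H3 by easy.
      specialize (H1 k). unfold a. apply Rabs_le. destruct Rle_dec; lra. }
  unfold energy in Hb.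
  rewrite !(lsum_ext A (fun i => Phi (glue A a _ i)) _ (fun i Hi => f_equal Phi (glue_in A a _ i Hi))) in Hb.
  rewrite lsum_scal, lsum_minus.
  assert (Hself : forall y, glue A y y = y).
  { intros y. apply functional_extensionality. intros k. unfold glue.
    now destruct excluded_middle_informative. }
  apply Rabs_le_between in Hb.
  destruct Hmin as [[-> Hm]|[-> Hm]]; unfold a in Hb; destruct Rle_dec; try lra;
    [pose proof (minimizer_glue A u v Hm)|pose proof (minimizer_glue A v u Hm)];
    rewrite Hself in Hb; lra.
Qed.

(** * Counting the translates of a minimal interval *)

Lemma tau_cancel k l (y : Conf d) : tau (psub p0 k) (- l) (tau k l y) = y.
Proof.
  apply functional_extensionality. intros i. unfold tau. rewrite opp_IZR.
  replace (padd (padd i (psub p0 k)) k) with i; [ring|]. symmetry. pt_ring.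
Qed.

Lemma tau_cll k l (y z : Conf d) : cll y z -> cll (tau k l y) (tau k l z).
Proof. intros H i. unfold tau. specialize (H (padd i k)). lra. Qed.

Lemma cll_trans (x y z : Conf d) : cll x y -> cll y z -> cll x z.
Proof. intros H1 H2 i. specialize (H1 i). specialize (H2 i). lra. Qed.

(** * Intervals between consecutive stationary configurations *)

Section Interval.

Context {u v : Conf d}.
Context (u_in : G u) (v_in : G v) (u_v : cll u v)
  (u_stat : forall i, grad i u = 0) (v_stat : forall i, grad i v = 0)
  (no_stat : forall y, G y -> (forall i, grad i y = 0) -> cll u y -> cll y v -> False).

Lemma tau_stat k l y : (forall i, grad i y = 0) -> forall i, grad i (tau k l y) = 0.
Proof. intros H i. now rewrite grad_shift. Qed.

(** Translates of [u] are stationary elements of [G], so none lies strictly between [u] and [v]. *)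
Lemma translate_above m l : cll u (tau m l u) -> cle v (tau m l u).
Proof.
  intros H. destruct (G_order v (tau m l u)) as [Hc|[Hc|Hc]]; auto.
  - intros i. left. apply Hc.
  - rewrite <- Hc. intros i. lra.
  - exfalso. apply (no_stat (tau m l u)); auto using tau_stat.
Qed.

Lemma translate_below m l : cll (tau m l u) u -> cle (tau m l v) u.
Proof.
  intros H. assert (Hc : cle v (tau (psub p0 m) (- l) u)).
  { apply translate_above. rewrite <- (tau_cancel m l u) at 1. now apply tau_cll. }
  intros i. specialize (Hc (padd i m)). unfold tau in *. rewrite opp_IZR in Hc.
  replace (padd (padd i m) (psub p0 m)) with i in Hc; [lra|]. symmetry. pt_ring.
Qed.

(** If a translation fixing [u] moved [v], it or its inverse would push [v] down to a stationary
    configuration strictly inside the interval. *)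
Lemma translate_same m l : tau m l u = u -> tau m l v = v.
Proof.
  intros H. destruct (G_order (tau m l v) v) as [Hc|[Hc|Hc]]; auto; exfalso.
  - apply (no_stat (tau m l v)); auto using tau_stat. rewrite <- H. now apply tau_cll.
  - apply (no_stat (tau (psub p0 m) (- l) v)); auto using tau_stat.
    + rewrite <- (tau_cancel m l u), H. now apply tau_cll.
    + rewrite <- (tau_cancel m l v) at 2. now apply tau_cll.
Qed.

Lemma interval_width k : v k <= u k + 1.
Proof.
  assert (H : cle v (tau p0 1 u)).
  { apply translate_above. intros i. unfold tau.
    replace (padd i p0) with i by (symmetry; pt_ring). lra. }
  specialize (H k). unfold tau in H. replace (padd k p0) with k in H by (symmetry; pt_ring).
  exact H.
Qed.

(** The shifts of [u] by [k] and by [k'] then differ by an integer constant, so [[u, v]] is carried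
    to the same interval modulo 1. *)
Definition same_translate (k k' : Pt d) : Prop := exists l, tau (psub k k') l u = u.

Lemma same_translate_refl k : same_translate k k.
Proof.
  exists 0%Z. apply functional_extensionality. intros i. unfold tau.
  replace (padd i (psub k k)) with i by (symmetry; pt_ring). simpl. ring.
Qed.

Lemma same_translate_sym k k' : same_translate k k' -> same_translate k' k.
Proof.
  intros (l & H). exists (- l)%Z. rewrite <- H at 1.
  replace (psub k' k) with (psub p0 (psub k k')) by pt_ring. apply tau_cancel.
Qed.

(** The order of two translates at one site is their order everywhere, so [translate_above] and
    [translate_below] make the intervals at a site disjoint modulo 1. *)
Lemma widths_summable (L : list (Pt d)) i :
  ForallOrdPairs (fun k k' => ~ same_translate k k') L ->
  lsum L (fun k => v (padd i k) - u (padd i k)) <= 1.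
Proof.
  intros HL. apply (circle_packing (fun k => u (padd i k)) (fun k => v (padd i k))).
  - intros k _. pose proof (u_v (padd i k)). pose proof (interval_width (padd i k)). lra.
  - induction HL as [|k L Hk HL IH]; constructor; auto.
    eapply Forall_impl; [|exact Hk]. clear - G_order G_shift u_in v_in u_v u_stat v_stat no_stat S_shift S_partial.
    intros k' Hn l. simpl.
    assert (E : forall y : Conf d, tau (psub k k') (- l) y (padd i k') = y (padd i k) - IZR l).
    { intros y. unfold tau. rewrite opp_IZR.
      replace (padd (padd i k') (psub k k')) with (padd i k) by pt_ring. ring. }
    repeat split.
    + intros H. apply Hn. exists (- l)%Z. apply (coord_injective _ _ (padd i k')); auto.
      rewrite E. lra.
    + intros H. assert (Hc : cll (tau (psub k k') (- l) u) u).
      { apply (coord_lt _ _ (padd i k')); auto. rewrite E. lra. }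
      apply translate_below in Hc. specialize (Hc (padd i k')). rewrite E in Hc. lra.
    + intros H. assert (Hc : cll u (tau (psub k k') (- l) u)).
      { apply (coord_lt _ _ (padd i k')); auto. rewrite E. lra. }
      apply translate_above in Hc. specialize (Hc (padd i k')). rewrite E in Hc. lra.
Qed.

Lemma drop_same_translate k k' i : same_translate k k' ->
  Phi (v (padd i k)) - Phi (u (padd i k)) = Phi (v (padd i k')) - Phi (u (padd i k')).
Proof.
  intros (l & H).
  rewrite <- (primitive_shift Phi speed (IZR l) Phi_deriv (fun s => speed_shift s l)).
  pose proof (translate_same _ _ H) as H'.
  apply (f_equal (fun y => y (padd i k'))) in H, H'. unfold tau in H, H'.
  replace (padd (padd i k') (psub k k')) with (padd i k) in H, H' by pt_ring.
  now rewrite H, H'.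
Qed.

Lemma deep_translate A k i :
  deep A i -> deep (map (fun i => padd i k) A) (padd i k).
Proof.
  intros H j n Hj Hn. apply in_map_iff. exists (psub n k). split; [apply padd_psub|].
  apply (H (psub j k)); rewrite range_In in *.
  - replace (psub (psub j k) i) with (psub j (padd i k)) by pt_ring. easy.
  - replace (psub (psub n k) (psub j k)) with (psub n j) by pt_ring. easy.
Qed.

Lemma err_translate A k i : err (map (fun i => padd i k) A) (padd i k) <= err A i.
Proof.
  pose proof osc_nonneg. unfold err. do 2 destruct excluded_middle_informative; try lra.
  exfalso. auto using deep_translate.
Qed.

Lemma err_nonneg A i : 0 <= err A i.
Proof. pose proof osc_nonneg. unfold err. destruct excluded_middle_informative; lra. Qed.

(** Summed over the chosen shifts, the dissipation bound collects the drop at [i0] at least once for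
    each site of [A], while on the error side the widths at each site add up to at most 1. *)
Lemma no_dissipation sg i0 A :
  NoDup A ->
  (sg = 1 /\ global_minimizer r S u) \/ (sg = -1 /\ global_minimizer r S v) ->
  (forall i, 0 <= sg * (Phi (v i) - Phi (u i))) ->
  INR (length A) * (sg * (Phi (v i0) - Phi (u i0))) <= lsum A (err A).
Proof.
  intros HA Hmin Hpos. set (D := fun i => sg * (Phi (v i) - Phi (u i))).
  (* The shift by [psub i0 i] brings the drop at [i0] to site [i]. One shift per class is kept, lest
     an interval be counted twice modulo 1. *)
  destruct (class_representatives same_translate (map (psub i0) A)
    same_translate_refl same_translate_sym) as (L & HL & Hrep).
  apply Rle_trans with (lsum A (fun i => lsum L (fun k => D (padd i k)))).
  - rewrite <- lsum_const. apply lsum_le. intros i Hi.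
    destruct (Hrep (psub i0 i)) as (k & Hk & Hik); [now apply in_map|].
    apply Rle_trans with (D (padd i k)).
    + unfold D. rewrite <- (drop_same_translate _ _ i Hik).
      rewrite (padd_comm i), padd_psub. lra.
    + apply (lsum_ge_term L (fun k => D (padd i k))); auto. intros b _. apply Hpos.
  - rewrite lsum_swap.
    apply Rle_trans with (lsum L (fun k => lsum A (fun i => err A i * (v (padd i k) - u (padd i k))))).
    + apply lsum_le. intros k _.
      (* Instead of shifting [u] and [v] by [k], the domain is shifted; the minimizing end stays the
         same configuration. *)
      set (Ak := map (fun i => padd i k) A).
      pose proof (dissipation_bound sg Ak u v) as H. unfold Ak in H at 2 3. rewrite !lsum_map in H.
      eapply Rle_trans; [apply H; auto using interval_width|].
      { apply NoDup_map_NoDup_ForallPairs; [|easy]. intros a b _ _. apply padd_inj. }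
      apply lsum_le. intros i _. apply Rmult_le_compat_r; [|apply err_translate].
      pose proof (u_v (padd i k)). lra.
    + rewrite <- lsum_swap. apply lsum_le. intros i _. rewrite lsum_scal.
      rewrite <- (Rmult_1_r (err A i)) at 2. apply Rmult_le_compat_l; [apply err_nonneg|].
      now apply widths_summable.
Qed.

(** Depth involves two successive interactions, each changing a coordinate by at most [up r]. *)
Lemma cube_deep n i : In i (cube d n) -> deep (cube d (n + 2 * Z.to_nat (up r))) i.
Proof.
  intros Hi j k Hj Hk. rewrite cube_In in *. intros a. specialize (Hi a).
  apply range_In in Hj, Hk.
  assert (Hc : forall p q : Pt d, pnorm (psub p q) <= r -> (Z.abs (p a - q a) <= up r)%Z).
  { intros p q H. apply le_IZR. pose proof (pnorm_ge_coord (psub p q) a) as H'.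
    unfold psub at 1 in H'. destruct (archimed r). lra. }
  pose proof (Hc _ _ Hj). pose proof (Hc _ _ Hk). lia.
Qed.

Lemma cube_err n m : (forall i, In i (cube d n) -> deep (cube d (n + m)) i) ->
  lsum (cube d (n + m)) (err (cube d (n + m))) <=
  osc * (INR (length (cube d (n + m))) - INR (length (cube d n))).
Proof.
  intros Hd. set (A := cube d (n + m)) in *.
  set (g := fun i => if excluded_middle_informative (In i (cube d n)) then osc else 0).
  apply Rle_trans with (lsum A (fun i => osc - g i)).
  - apply lsum_le. intros i _. unfold err, g. pose proof osc_nonneg.
    do 2 destruct excluded_middle_informative; try lra. exfalso. auto.
  - rewrite lsum_minus, lsum_const, (lsum_incl (cube d n) A); try apply cube_NoDup.
    + rewrite (lsum_ext (cube d n) g (fun _ => osc)), lsum_const; [lra|].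
      intros i Hi. unfold g. now destruct excluded_middle_informative.
    + intros i Hi. unfold A. rewrite cube_In in *. intros a. specialize (Hi a). lia.
    + intros i _ Hi. unfold g. now destruct excluded_middle_informative.
Qed.

Lemma interval_impossible sg i0 :
  (sg = 1 /\ global_minimizer r S u) \/ (sg = -1 /\ global_minimizer r S v) ->
  (forall i, 0 <= sg * (Phi (v i) - Phi (u i))) ->
  0 < sg * (Phi (v i0) - Phi (u i0)) -> False.
Proof.
  intros Hmin Hpos Hi0. set (kap := sg * _) in Hi0. pose proof osc_nonneg as Ho.
  set (m := (2 * Z.to_nat (up r))%nat).
  (* Dividing by [osc + 1] covers [osc = 0] and keeps the total error strictly below [kap * N]. *)
  assert (He : 0 < kap / (osc + 1)) by (apply Rdiv_lt_0_compat; lra).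
  destruct (cube_shell_negligible d m _ He) as (n & Hn).
  pose proof (no_dissipation sg i0 (cube d (n + m)) (cube_NoDup _ _) Hmin Hpos) as H1.
  pose proof (cube_err n m (cube_deep n)) as H2. fold kap in H1.
  set (N := INR (length (cube d (n + m)))) in *.
  assert (HN : 0 < N).
  { unfold N. rewrite cube_length. apply lt_0_INR. apply Nat.neq_0_lt_0, Nat.pow_nonzero. lia. }
  set (sh := N - INR (length (cube d n))) in *.
  assert (H3 : osc * sh <= osc * (kap / (osc + 1) * N)) by (apply Rmult_le_compat_l; lra).
  replace (osc * (kap / (osc + 1) * N)) with (kap * N - kap / (osc + 1) * N) in H3 by (field; lra).
  assert (0 < kap / (osc + 1) * N) by now apply Rmult_lt_0_compat.
  lra.
Qed.

End Interval.

(** * Absence of motion in the gap *)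

(** A nonstationary [z] would lie in an interval of motion with stationary ends between [ym] and
    [yp]. Both ends are minimizers by hypothesis, in particular the one the flow leaves, which
    [interval_impossible] excludes. *)
Lemma unforced_interval_minimizers ym yp z i : G ym -> G yp -> G z ->
  (forall i, grad i ym = 0) -> (forall i, grad i yp = 0) -> cle ym z -> cle z yp ->
  (forall y, G y -> cle ym y -> cle y yp -> (forall i, grad i y = 0) -> global_minimizer r S y) ->
  grad i z = 0.
Proof.
  intros Gm Gp Gz Hm Hp Hmz Hzp Hall. apply NNPP. intros Hne.
  assert (Hsg : exists sg, (sg = 1 \/ sg = -1) /\ 0 < sg * speed (z i)).
  { rewrite grad_speed in Hne by easy.
    destruct (Rtotal_order (speed (z i)) 0) as [H|[H|H]]; [exists (-1)|lra|exists 1]; split; auto; lra. }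
  destruct Hsg as (sg & Hsg & Hi).
  assert (Hmov : moving sg (z p0)) by (exists i; now rewrite curve_of).
  destruct (moving_interval sg ym yp z) as (u & v & Gu & Gv & Hmu & Hvp & Huz & Hzv & Hu & Hv & Hb);
    auto.
  assert (Huv : cll u v) by (eapply cll_trans; eauto).
  assert (Huw : cle u v) by (intros k; left; apply Huv).
  assert (Hmv : cle ym v) by (intros k; specialize (Hmu k); specialize (Huw k); lra).
  assert (Hup : cle u yp) by (intros k; specialize (Hvp k); specialize (Huw k); lra).
  assert (Hder : forall s, derivable_pt_lim (fun s => sg * Phi s) s (sg * speed s)).
  { intros s. apply derivable_pt_lim_scal, Phi_deriv. }
  (* Every number between [u k] and [v k] is the value at [k] of a configuration between [u] and
     [v], where some site moves in the direction [sg] and hence none moves against it. *)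
  assert (Hsign : forall k s, u k < s < v k -> 0 <= sg * speed s).
  { intros k s Hs. destruct (coord_surjective k s) as (y & Gy & <-).
    destruct (Hb y Gy) as (j & Hj); [apply (coord_lt _ _ k); auto; lra..|].
    rewrite curve_of in Hj by easy. now apply (speed_sign y j). }
  apply (interval_impossible (u := u) (v := v) Gu Gv Huv Hu Hv) with (sg := sg) (i0 := i).
  - intros y Gy Hy Huy Hyv. now apply (stationary_not_moving sg y Gy Hy), Hb.
  - destruct Hsg as [-> | ->]; [left|right]; auto.
  - intros k. pose proof (primitive_mono _ _ (u k) (v k) Hder (Huw k) (Hsign k)). lra.
  - pose proof (primitive_strict _ _ (u i) (v i) (z i) Hder (Hsign i) (conj (Huz i) (Hzv i)) Hi). lra.
Qed.

End GhostCircle.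

(** Opposite signs at two sites would make [Psi h y], for small [h], lie below [y] at one site and
    above it at the other, against the strict order of [G]. *)
Lemma flow_sign {d : nat} {r : R} {dS : Pt d -> Pt d -> Conf d -> R}
  {R0 : list (Pt d)} (R0_nodup : NoDup R0) (R0_ball : forall k, In k R0 <-> pnorm k <= r)
  (Psi : R -> Conf d -> Conf d) (G : Conf d -> Prop) :
  is_grad_flow r dS Psi -> ghost_circle Psi G ->
  forall y i k, G y -> 0 < grad (dS := dS) (R0 := R0) i y -> 0 <= grad (dS := dS) (R0 := R0) k y.
Proof.
  intros Hflow (GX & _ & _ & _ & Gord & _ & Ginv) y i k Gy Hi.
  apply Rnot_lt_le. intros Hk.
  destruct (Hflow y (GX y Gy)) as (E0 & _ & Hd).
  assert (Hder : forall j, derivable_pt_lim (fun s => Psi s y j) 0 (- grad (dS := dS) (R0 := R0) j y)).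
  { intros j. destruct (Hd 0 j) as (g & Hg & H). rewrite E0 in Hg.
    now rewrite <- (gradW_unique R0_nodup R0_ball _ _ _ Hg). }
  destruct (Hder i _ Hi) as (e1 & H1).
  assert (Hk' : 0 < - grad (dS := dS) (R0 := R0) k y) by lra.
  destruct (Hder k _ Hk') as (e2 & H2).
  set (h := Rmin e1 e2 / 2).
  assert (Hh : 0 < h /\ h < e1 /\ h < e2).
  { unfold h. pose proof (Rmin_pos e1 e2 (cond_pos e1) (cond_pos e2)).
    pose proof (Rmin_l e1 e2). pose proof (Rmin_r e1 e2). lra. }
  specialize (H1 h ltac:(lra) ltac:(rewrite Rabs_pos_eq; lra)).
  specialize (H2 h ltac:(lra) ltac:(rewrite Rabs_pos_eq; lra)).
  rewrite !Rplus_0_l, !E0 in H1, H2. apply Rabs_def2 in H1, H2.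
  assert (Hq1 : (Psi h y i - y i) / h * h < 0 * h) by (apply Rmult_lt_compat_r; lra).
  assert (Hq2 : 0 * h < (Psi h y k - y k) / h * h) by (apply Rmult_lt_compat_r; lra).
  replace ((Psi h y i - y i) / h * h) with (Psi h y i - y i) in Hq1 by (field; lra).
  replace ((Psi h y k - y k) / h * h) with (Psi h y k - y k) in Hq2 by (field; lra).
  destruct (Gord (Psi h y) y (proj1 (Ginv h) y Gy) Gy) as [Hc|[Hc|Hc]].
  - specialize (Hc k). lra.
  - rewrite Hc in Hq1. lra.
  - specialize (Hc i). lra.
Qed.

Theorem mainTheorem20 (d : nat) (r : R) (S : Pt d -> Conf d -> R)
  (dS : Pt d -> Pt d -> Conf d -> R) (d2S : Pt d -> Pt d -> Pt d -> Conf d -> R)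
  (Psi : R -> Conf d -> Conf d) (w : Fin.t d -> R) (x ym yp : Conf d)
  (G : Conf d -> Prop) :
  potentials_ok d r S dS d2S ->
  is_grad_flow r dS Psi ->
  Bbar w x -> global_minimizer r S x ->
  is_gap (AM w x) ym yp ->
  ghost_circle Psi G ->
  (forall y, AM w x y -> G y) ->
  (forall y, G y -> cle ym y -> cle y yp -> global_minimizer r S y) \/
  (exists y, G y /\ cle ym y /\ cle y yp /\ stationary r dS y /\ ~ global_minimizer r S y).
Proof.
  intros (Hr & Hloc & HS & HdS & Hcont & _ & Hshift & _ & _ & _ & _ & (C & HC))
    Hflow _ Hx (Hym & Hyp & _ & _) Hghost HAM.
  pose proof Hghost as (GX & (e & Ge) & _ & Gconn & Gord & Gshift & _).
  (* Finiteness of the ball is read off from the flow: its gradient at the origin is a sum over a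
     duplicate-free list. *)
  assert (HR0 : exists R0, NoDup R0 /\ forall k : Pt d, In k R0 <-> pnorm k <= r).
  { destruct (Hflow e (GX e Ge)) as (_ & _ & Hd). destruct (Hd 0 p0) as (g & (L & HL & Hin & _) & _).
    exists L. split; [easy|]. intros k. rewrite Hin. now replace (psub k p0) with k by pt_ring. }
  destruct HR0 as (R0 & Hnd & Hball).
  pose proof (stationary_grad (dS := dS) Hnd Hball) as Hstat.
  assert (HAMstat : forall y, AM w x y -> forall i, grad (dS := dS) (R0 := R0) i y = 0).
  { intros y [Hy _]. apply (closure_stationary HS Hcont Hshift x); auto.
    intros i. now apply (minimizer_stationary Hnd Hball Hr Hloc HS). }
  (* If the second alternative fails, every stationary configuration in the gap is a minimizer, and
     it remains to show that all of them are stationary there. *)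
  destruct (classic (exists y, G y /\ cle ym y /\ cle y yp /\ stationary r dS y
    /\ ~ global_minimizer r S y)) as [H|H]; [now right|left].
  assert (Hall : forall y, G y -> cle ym y -> cle y yp -> stationary r dS y -> global_minimizer r S y).
  { intros y Gy H1 H2 H3. apply NNPP. intros H4. apply H. now exists y. }
  intros z Gz Hz1 Hz2. apply Hall; auto. apply Hstat. intros i.
  apply (unforced_interval_minimizers Hnd Hball Hr Hloc HS HdS Hcont Hshift HC (G := G))
    with (ym := ym) (yp := yp); auto.
  - now exists e.
  - now apply (flow_sign Hnd Hball Psi).
  - intros y Gy H1 H2 H3. apply Hall; auto. now apply Hstat.
Qed.
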